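(* Let $\mathbb{R}^d=\mathbb{R}^{d_1}\times\mathbb{R}^{d_2}$ and let $\vec\beta=(\beta_1,\beta_2)$ with $\beta_1,\beta_2\in(0,1)$. Then $$\dot{\mathrm{VC}}^{0,\vec\beta}(\mathbb{R}^d)=\overline{C_c^\infty(\mathbb{R}^d)}^{\,\dot C^{0,\vec\beta}(\mathbb{R}^d)},$$ i.e. $\dot{\mathrm{VC}}^{0,\vec\beta}(\mathbb{R}^d)$ is the closure of $C_c^\infty(\mathbb{R}^d)$ with respect to the seminorm of $\dot C^{0,\vec\beta}(\mathbb{R}^d)$.
   Context: Write $x=(x_1,x_2)$, $y=(y_1,y_2)\in\mathbb{R}^{d_1}\times\mathbb{R}^{d_2}$. The bi-parameter homogeneous Hölder space $\dot C^{0,\vec\beta}(\mathbb{R}^d)=\dot C^{0,\beta_1,\beta_2}(\mathbb{R}^d)$ is given by the seminorm $$\|b\|_{\dot C^{0,\beta_1,\beta_2}}=\sup_{x_1\ne y_1,\;x_2\ne y_2}\frac{|b(x_1,x_2)-b(x_1,y_2)-b(y_1,x_2)+b(y_1,y_2)|}{|x_1-y_1|^{\beta_1}|x_2-y_2|^{\beta_2}}.$$ $b\in\dot C^{0,\beta_1,\beta_2}$ belongs to $\dot{\mathrm{VC}}^{0,\beta_1,\beta_2}$ if for all $\varepsilon>0$ there exists $t>0$ so that $$|b(x_1,x_2)-b(x_1,y_2)-b(y_1,x_2)+b(y_1,y_2)|\le\varepsilon|x_1-y_1|^{\beta_1}|x_2-y_2|^{\beta_2}$$ whenever $|x_i-y_i|<t$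 or $|x_i|>t^{-1}$ or $|y_i|>t^{-1}$ for $i=1$ or $i=2$. The closure consists of those $f$ for which $\inf_{\varphi\in C_c^\infty(\mathbb{R}^d)}\|f-\varphi\|_{\dot C^{0,\vec\beta}}=0$. *)

(* Defs.v *)
From HB Require Import structures.
From mathcomp Require Import all_boot all_order all_algebra.
From mathcomp Require Import all_classical all_reals all_analysis.

Set Implicit Arguments.
Unset Strict Implicit.
Unset Printing Implicit Defensive.

Import Order.TTheory GRing.Theory Num.Theory.
Import numFieldNormedType.Exports.

Local Open Scope classical_set_scope.
Local Open Scope ring_scope.

(* The library norm `|x| on 'rV[R]_n is the max norm, whereas moduli of points
   of R^n are Euclidean here. *)
Definition enorm (R : realType) (n : nat) (x : 'rV[R]_n) : R :=
  Num.sqrt (\sum_(i < n) x ord0 i ^+ 2).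

Section Smooth.
Context {R : realType} {V : normedModType R}.

(* Intended for finite-dimensional V, where continuity of x |-> 'd f x amounts
   to continuity of every directional derivative 'D_v f. *)
Fixpoint of_class_C (k : nat) (f : V -> R) : Prop :=
  if k is k'.+1 then
    (forall x, differentiable f x) /\ (forall v, of_class_C k' ('D_v f))
  else continuous f.

Definition smooth (f : V -> R) : Prop := forall k, of_class_C k f.

Definition compactly_supported (f : V -> R) : Prop :=
  compact (closure [set x | f x != 0]).

Definition Cc_infty : set (V -> R) :=
  [set f | smooth f /\ compactly_supported f].

End Smooth.

Section BiParameterHolder.
Context {R : realType} {d1 d2 : nat}.
Implicit Types b f : 'rV[R]_d1 * 'rV[R]_d2 -> R.

Definition rect_diff b (x1 y1 : 'rV[R]_d1) (x2 y2 : 'rV[R]_d2) : R :=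
  b (x1, x2) - b (x1, y2) - b (y1, x2) + b (y1, y2).

(* If d1 or d2 is 0 the supremum is over the empty set and equals -oo. *)
Definition holder_seminorm (beta1 beta2 : R) b : \bar R :=
  ereal_sup [set q : \bar R | exists x1 y1 x2 y2,
    [/\ x1 != y1, x2 != y2 &
        q = (`|rect_diff b x1 y1 x2 y2| /
             (enorm (x1 - y1) `^ beta1 * enorm (x2 - y2) `^ beta2))%:E]].

Definition holder (beta1 beta2 : R) : set ('rV[R]_d1 * 'rV[R]_d2 -> R) :=
  [set b | (holder_seminorm beta1 beta2 b < +oo)%E].

Definition near_or_far (n : nat) (t : R) (x y : 'rV[R]_n) : Prop :=
  [\/ enorm (x - y) < t, t^-1 < enorm x | t^-1 < enorm y].

Definition VC (beta1 beta2 : R) : set ('rV[R]_d1 * 'rV[R]_d2 -> R) :=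
  [set b | holder beta1 beta2 b /\
    forall eps : R, 0 < eps -> exists2 t : R, 0 < t &
      forall x1 y1 x2 y2, near_or_far t x1 y1 \/ near_or_far t x2 y2 ->
        `|rect_diff b x1 y1 x2 y2| <=
          eps * enorm (x1 - y1) `^ beta1 * enorm (x2 - y2) `^ beta2].

Definition holder_closure (beta1 beta2 : R)
    (A : set ('rV[R]_d1 * 'rV[R]_d2 -> R)) :
    set ('rV[R]_d1 * 'rV[R]_d2 -> R) :=
  [set f |
    ereal_inf [set holder_seminorm beta1 beta2 (f \- phi) | phi in A] = 0%E].

End BiParameterHolder.

(* Main.v *)
Require Import Defs.
From mathcomp Require Import all_boot all_order all_algebra.
From mathcomp Require Import all_classical all_reals all_analysis.
From mathcomp Require Import ring lra.

(* Work with the max norm, equivalent to the Euclidean one, and subtract from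
   b its traces on the axes through 0, which leaves rect_diff unchanged.
   Given b in VC and eps > 0:
   - Truncation: compose b with P1 x P2, where P x = lam(|x|) x for a
     logarithmic cutoff lam, equal to 1 up to N and to 0 far away.  Each P is
     2-Lipschitz, and off the ball of radius N either it lands where VC makes
     rect_diff small or it is a strong contraction, so b - b o (P1 x P2) has
     small seminorm.
   - Smoothing: interpolate b o (P1 x P2) on a lattice of mesh h by a tensor
     product partition of unity.  In each variable the operator S - I has
     increments controlled by the Hoelder bound at distances at most 4h only;
     applied to (S1 x S2) - I = (S1 - I) x I + I x (S2 - I) +
     (S1 - I) x (S2 - I), VC at distances < t gives the smallness.
   Conversely two applications of the mean value theorem bound rect_diff of a
   test function by C |x1 - y1| |x2 - y2|; with compact support this puts it in
   VC, and VC is closed for the seminorm. *)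

Import Order.TTheory GRing.Theory Num.Theory.
Import numFieldNormedType.Exports.

Local Open Scope classical_set_scope.
Local Open Scope ring_scope.

Set Implicit Arguments.
Unset Strict Implicit.

(** * Smooth functions *)

Section SmoothCalculus.
Context {R : realType} {V : normedModType R}.
Implicit Types (f g : V -> R) (k : nat).

Lemma of_class_CS_cont k f : of_class_C k f -> continuous f.
Proof.
case: k => // k [df _] x; exact: differentiable_continuous.
Qed.

(** The product and quotient rules put [f] itself next to its derivative, so inductions on the order
    need [f] one order lower. *)
Lemma of_class_C_pred k f : of_class_C k.+1 f -> of_class_C k f.
Proof.
elim: k f => [|k IH] f; first exact: of_class_CS_cont.
by move=> [df Df]; split=> // v; exact: IH.
Qed.

Lemma of_class_C_cst k (c : R) : of_class_C k (cst c : V -> R).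
Proof.
elim: k c => [|k IH] c; first exact: cst_continuous.
split; first by move=> x; exact: differentiable_cst.
move=> v; suff -> : 'D_v (cst c : V -> R) = cst 0 by exact: IH.
by apply/funext => x; rewrite derive_cst.
Qed.

Lemma of_class_CD k f g :
  of_class_C k f -> of_class_C k g -> of_class_C k (f \+ g).
Proof.
elim: k f g => [|k IH] f g.
  by move=> cf cg x; apply: cvgD; [exact: cf|exact: cg].
move=> [df Df] [dg Dg]; split; first by move=> x; exact: differentiableD.
move=> v; suff -> : 'D_v (f \+ g) = 'D_v f \+ 'D_v g by apply: IH; [exact: Df|exact: Dg].
by apply/funext => x; rewrite deriveD//=; exact: diff_derivable.
Qed.

Lemma of_class_CM k f g :
  of_class_C k f -> of_class_C k g -> of_class_C k (f \* g).
Proof.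
elim: k f g => [|k IH] f g.
  by move=> cf cg x; apply: cvgM; [exact: cf|exact: cg].
move=> Cf Cg; have [[df Df] [dg Dg]] := (Cf, Cg).
split; first by move=> x; exact: differentiableM.
move=> v; suff -> : 'D_v (f \* g) = (f \* 'D_v g) \+ (g \* 'D_v f).
  by apply: of_class_CD; apply: IH; first [exact: of_class_C_pred|exact: Df|exact: Dg].
by apply/funext => x; rewrite deriveM//=; exact: diff_derivable.
Qed.

Lemma of_class_CV k f : (forall x, f x != 0) ->
  of_class_C k f -> of_class_C k (fun x => (f x)^-1).
Proof.
move=> f0; elim: k => [|k IH].
  by move=> cf x; apply: cvgV => //; exact: cf.
move=> Cf; have [df Df] := Cf.
split; first by move=> x; exact: differentiableV.
move=> v; have iC := IH (of_class_C_pred Cf).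
suff -> : 'D_v (fun x => (f x)^-1) =
    (cst (-1)) \* (((fun x => (f x)^-1) \* (fun x => (f x)^-1)) \* 'D_v f).
  do 2?[apply: of_class_CM]; [exact: of_class_C_cst| |exact: Df].
  exact: of_class_CM.
apply/funext => x; rewrite deriveV//; last exact: diff_derivable.
by rewrite /= /GRing.scale /= expr2 invfM mulN1r mulNr.
Qed.

Lemma of_class_C_sum k (I : Type) (r : seq I) (F : I -> V -> R) :
  (forall i, of_class_C k (F i)) ->
  of_class_C k (fun x => \sum_(i <- r) F i x).
Proof.
move=> CF; elim: r => [|i r IH].
  rewrite (_ : (fun _ => _) = cst 0); first exact: of_class_C_cst.
  by apply/funext => x; rewrite big_nil.
rewrite (_ : (fun _ => _) = F i \+ (fun x => \sum_(i <- r) F i x)).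
  exact: of_class_CD.
by apply/funext => x; rewrite big_cons.
Qed.

Lemma of_class_C_prod k (I : Type) (r : seq I) (F : I -> V -> R) :
  (forall i, of_class_C k (F i)) ->
  of_class_C k (fun x => \prod_(i <- r) F i x).
Proof.
move=> CF; elim: r => [|i r IH].
  rewrite (_ : (fun _ => _) = cst 1); first exact: of_class_C_cst.
  by apply/funext => x; rewrite big_nil.
rewrite (_ : (fun _ => _) = F i \* (fun x => \prod_(i <- r) F i x)).
  exact: of_class_CM.
by apply/funext => x; rewrite big_cons.
Qed.

(** [L] does not depend on [x], so ['D_v (f \o l)] is ['D_(L v) f \o l], again a composition with
    [l], and the induction closes. *)
Lemma of_class_C_comp (W : normedModType R) k (f : W -> R)
    (l L : V -> W) :
  (forall x, is_diff x l L) -> of_class_C k f -> of_class_C k (f \o l).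
Proof.
move=> dl; elim: k f => [|k IH] f.
  move=> cf x; apply: continuous_comp; last exact: cf.
  exact/differentiable_continuous/(@ex_diff _ _ _ _ _ _ _ (dl x)).
move=> [df Df]; split=> [x|v].
  exact/differentiable_comp/df/(@ex_diff _ _ _ _ _ _ _ (dl x)).
have dlx x := @ex_diff _ _ _ _ _ _ _ (dl x).
suff -> : 'D_v (f \o l) = 'D_(L v) f \o l by apply: IH; exact: Df.
apply/funext => x; rewrite deriveE; last exact: differentiable_comp.
by rewrite diff_comp//= (@diff_val _ _ _ _ _ _ _ (dl x)) deriveE.
Qed.

End SmoothCalculus.

(** * A smooth step function *)

Section SmoothStep.
Context {R : realType}.

(** The exponent [n] makes the family stable under differentiation, up to linear combinations. *)
Definition flat (n : nat) (x : R^o) : R :=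
  if 0 < x then x ^- n * expR (- x^-1) else 0.

Lemma flat_ge0 n x : 0 <= flat n x.
Proof.
rewrite /flat; case: ifPn => // x0.
by rewrite mulr_ge0 ?expR_ge0// invr_ge0 exprn_ge0// ltW.
Qed.

(** The term of order n + 2 in the series of e^u, at u = 1/x. A quadratic bound forces the
    derivative at 0 to vanish for every [n]. *)
Lemma flat_le n x : flat n x <= (n.+2)`!%:R * x ^+ 2.
Proof.
rewrite /flat; case: ifPn => x0; last by rewrite mulr_ge0// sqr_ge0.
have u0 : 0 < x^-1 by rewrite invr_gt0.
have h : (x^-1) ^+ n.+2 / n.+2`!%:R <= expR x^-1.
  by apply: (le_trans _ (expR_ge1Dxn n.+1 (ltW u0))); rewrite lerDr.
rewrite ler_pdivrMr ?ltr0n ?fact_gt0// mulrC in h.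
rewrite expRN ler_pdivrMr ?expR_gt0// mulrAC -ler_pdivrMr ?exprn_gt0//.
by rewrite -exprVn -[(x ^+ 2)^-1]exprVn -exprD addn2.
Qed.

Lemma is_derive_flat0 n : is_derive (0 : R^o) 1 (flat n) 0.
Proof.
have f0 : flat n 0 = 0 by rewrite /flat ltxx.
have H : h^-1 *: (flat n (h *: 1 + 0) - flat n 0) @[h --> 0^'] --> (0 : R).
  apply/cvgr0Pnorm_le => e e0.
  pose c : R := (n.+2)`!%:R.
  have c0 : 0 < c by rewrite ltr0n fact_gt0.
  near=> h.
  have h0 : h != 0 by near: h; exact: nbhs_dnbhs_neq.
  rewrite f0 subr0 addr0 [_ *: 1]mulr1 normrM normfV ler_pdivrMl ?normr_gt0//.
  rewrite ger0_norm ?flat_ge0// (le_trans (flat_le _ _))// -/c.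
  rewrite -real_normK ?num_real// expr2 mulrA [leRHS]mulrC ler_wpM2r// mulrC.
  rewrite -ler_pdivlMr//; near: h; apply: dnbhs0_le; exact: divr_gt0.
apply: DeriveDef; last exact: cvg_lim H.
by apply/cvg_ex; exists 0.
Unshelve. all: by end_near. Qed.

Lemma is_derive_flat n (x : R^o) :
  is_derive x 1 (flat n) (flat n.+2 x - n%:R * flat n.+1 x).
Proof.
case: (ltgtP x 0) => [x0|x0|->]; last first.
- by rewrite /flat ltxx mulr0 subrr; exact: is_derive_flat0.
- pose f := fun y : R => y^-1 ^+ n * expR (- y^-1).
  apply: (@near_eq_is_derive _ _ _ f).
    near=> y; rewrite /f /flat exprVn.
    by have -> : 0 < y by near: y; exact: lt_nbhsr.
  have x_neq0 : x != 0 by rewrite gt_eqF.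
  have dV : is_derive (x : R) 1 (fun y : R => y^-1) (- x ^- 2).
    apply: is_derive_eq; first exact: is_deriveV.
    by rewrite [_ *: _]mulr1.
  have dE : is_derive (x : R) 1 (fun y : R => expR (- y^-1))
      (expR (- x^-1) * x ^- 2).
    have dN : is_derive (x : R) 1 (fun y : R => - y^-1) (x ^- 2).
      by rewrite -[x ^- 2]opprK; exact: is_deriveN.
    exact: (@is_derive1_comp _ expR (fun y : R => - y^-1)).
  have dX : is_derive (x : R) 1 (fun y : R => y^-1 ^+ n)
      ((n%:R * x^-1 ^+ n.-1) * - x ^- 2).
    rewrite (_ : (fun _ => _) = (fun y : R => y^-1) ^+ n); last first.
      by apply/funext => y; rewrite fctE.
    exact: is_deriveX.
  rewrite (_ : _ - _ = x^-1 ^+ n * (expR (- x^-1) * x ^- 2) +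
     expR (- x^-1) * ((n%:R * x^-1 ^+ n.-1) * - x ^- 2)).
    exact: (@is_deriveM _ _ (fun y : R => y^-1 ^+ n) (fun y : R => expR (- y^-1))).
  rewrite /flat x0 /GRing.scale /=.
  rewrite -!exprVn; move: (x^-1) (expR _) => u E.
  (* Splitting on [n] disposes of the predecessor in the power rule. *)
  by case: n {f dX} => [|m]; rewrite /= ?mul0r ?mulr0 ?subr0 ?addr0 !exprS; ring.
- apply: (@near_eq_is_derive _ _ _ (cst 0)).
    near=> y; rewrite /flat ifF//; apply/negbTE; rewrite -leNgt ltW//.
    by near: y; exact: lt_nbhsl.
  by rewrite /flat lt_gtF// mulr0 subrr; exact: is_derive_cst.
Unshelve. all: by end_near. Qed.

Lemma of_class_C_flat k n : of_class_C k (flat n : R^o -> R).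
Proof.
elim: k n => [|k IH] n.
  move=> x; apply/differentiable_continuous/derivable1_diffP.
  exact: (@ex_derive _ _ _ _ _ _ _ (is_derive_flat n x)).
have df x : differentiable (flat n : R^o -> R) x.
  apply/derivable1_diffP; exact: (@ex_derive _ _ _ _ _ _ _ (is_derive_flat n x)).
split=> // v.
suff -> : 'D_v (flat n) =
   (cst v : R^o -> R) \* (flat n.+2 \+ (cst (- n%:R) \* flat n.+1)).
  apply: of_class_CM; first exact: of_class_C_cst.
  apply: of_class_CD; first exact: IH.
  by apply: of_class_CM; [exact: of_class_C_cst|exact: IH].
apply/funext => x; rewrite deriveE// diff1E//= derive1E.
by rewrite (@derive_val _ _ _ _ _ _ _ (is_derive_flat n x)) mulNr.
Qed.

Lemma flat0_nd : {homo flat 0 : x y / x <= y}.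
Proof.
move=> x y xy; rewrite {1}/flat; case: ifPn => x0; last exact: flat_ge0.
rewrite /flat (lt_le_trans x0 xy) !expr0 !invr1 !mul1r ler_expR lerN2.
by rewrite lef_pV2// posrE// (lt_le_trans x0 xy).
Qed.

Definition smooth_step (x : R^o) : R :=
  flat 0 x / (flat 0 x + flat 0 (1 - x)).

Lemma flat0_gt0 x : 0 < x -> 0 < flat 0 x.
Proof. by rewrite /flat => ->; rewrite expr0 invr1 mul1r expR_gt0. Qed.

Lemma flat0_eq0 x : x <= 0 -> flat 0 x = 0.
Proof. by rewrite /flat leNgt => /negbTE ->. Qed.

(** x and 1 - x are never both nonpositive. *)
Lemma smooth_step_den x : 0 < flat 0 x + flat 0 (1 - x).
Proof.
case: (ltP 0 x) => x0; first by rewrite ltr_pwDl ?flat0_gt0 ?flat_ge0.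
by rewrite ltr_wpDl ?flat_ge0// flat0_gt0// subr_gt0 (le_lt_trans x0).
Qed.

Lemma smooth_smooth_step : smooth smooth_step.
Proof.
move=> k; apply: of_class_CM; first exact: of_class_C_flat.
apply: of_class_CV => [x|]; first by rewrite gt_eqF// smooth_step_den.
apply: of_class_CD; first exact: of_class_C_flat.
have dl (x : R^o) : is_diff x (fun x : R^o => 1 - x) (-%R : R^o -> R^o).
  have -> : (fun x : R^o => 1 - x) = cst 1 - id :> (R^o -> R^o) by [].
  by apply: is_diff_eq; rewrite sub0r.
exact: (@of_class_C_comp _ _ _ _ (flat 0) _ _ dl (of_class_C_flat k 0)).
Qed.

Lemma smooth_step_le0 x : x <= 0 -> smooth_step x = 0.
Proof. by move=> x0; rewrite /smooth_step flat0_eq0// mul0r. Qed.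

Lemma smooth_step_ge1 x : 1 <= x -> smooth_step x = 1.
Proof.
move=> x1; rewrite /smooth_step (@flat0_eq0 (1 - x)) ?subr_le0// addr0 divff//.
by rewrite gt_eqF// flat0_gt0// (lt_le_trans ltr01).
Qed.

Lemma smooth_step_nd : {homo smooth_step : x y / x <= y}.
Proof.
move=> x y xy; rewrite /smooth_step ler_pdivrMr ?smooth_step_den// mulrAC.
rewrite ler_pdivlMr ?smooth_step_den//.
have h1 := flat0_nd xy; have h2 := @flat0_nd (1 - y) (1 - x).
rewrite lerB// in h2; have {}h2 := h2 isT.
(* After cross-multiplication the products of [flat 0 x] and [flat 0 y] cancel; the two monotonicity
   facts finish. *)
rewrite !mulrDr (mulrC (flat 0 y)) lerD2l.
by apply: ler_pM; rewrite ?flat_ge0.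
Qed.

Lemma smooth_step_ge0 x : 0 <= smooth_step x.
Proof. by rewrite divr_ge0 ?flat_ge0// ltW// smooth_step_den. Qed.

Lemma smooth_step_le1 x : smooth_step x <= 1.
Proof. by rewrite ler_pdivrMr ?smooth_step_den// mul1r lerDl flat_ge0. Qed.

Definition clamp01 (x : R) : R := Num.max 0 (Num.min 1 x).

Lemma smooth_step_clamp x : smooth_step x = smooth_step (clamp01 x).
Proof.
rewrite /clamp01; case: (ltP 1 x) => x1.
  by rewrite (max_idPr ler01) !smooth_step_ge1// ltW.
by case: (leP 0 x) => // x0; rewrite !smooth_step_le0// ltW.
Qed.

Lemma clamp01_itv x : 0 <= clamp01 x <= 1.
Proof. by rewrite /clamp01 le_max lexx/= ge_max ler01/= ge_min lexx. Qed.

(** The step factors through [clamp01], so the mean value theorem is applied inside [0, 1], where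
    the continuous derivative is bounded. *)
Lemma smooth_step_lip : exists2 L : R, 0 < L &
  forall x y, x <= y ->
    smooth_step y - smooth_step x <= L * (clamp01 y - clamp01 x).
Proof.
have [ds Ds] := smooth_smooth_step 1.
have cD : {within `[(0 : R), 1], continuous (fun x => `|'D_1 smooth_step x|)}.
  apply: continuous_subspaceT => x.
  by apply: cvg_norm; exact: (Ds 1).
have [c _ cmax] := EVT_max ler01 cD.
exists (`|'D_1 smooth_step c| + 1); first by rewrite ltr_wpDl.
move=> x y xy; rewrite (smooth_step_clamp x) (smooth_step_clamp y).
have cxy : clamp01 x <= clamp01 y.
  by rewrite /clamp01; move: xy; rewrite !maxEle !minEle; do !case: ifPn; lra.
have cs z : z \in `]clamp01 x, clamp01 y[ ->
    is_derive (z : R) 1 smooth_step ('D_1 smooth_step z).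
  by move=> _; apply/derivableP/derivable1_diffP; exact: ds.
have [|z zc ->] := MVT_segment cxy cs.
  by apply: continuous_subspaceT => z; exact: differentiable_continuous.
rewrite ler_wpM2r ?subr_ge0// (le_trans (ler_norm _))//.
have zi : z \in `[(0 : R), 1].
  move: zc; rewrite !in_itv/= => /andP[z1 z2].
  have /andP[? _] := clamp01_itv x; have /andP[_ ?] := clamp01_itv y.
  by apply/andP; split; [exact: le_trans z1|exact: le_trans z2 _].
by rewrite (le_trans (cmax _ zi))// lerDl.
Qed.

(** Each term is the length of the part of [0, s] inside [j, j + 1], and these lengths add up. *)
Lemma sum_clamp01 (m : nat) (s : R) :
  \sum_(j < m) clamp01 (s - j%:R) = Num.max 0 (Num.min m%:R s).
Proof.
elim: m => [|m IH].
  by rewrite big_ord0; rewrite maxEle minEle; do !case: ifPn; lra.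
rewrite big_ord_recr/= IH /clamp01 -natr1.
have : 0 <= m%:R :> R by [].
by move: (m%:R : R) => r r0; rewrite !maxEle !minEle; do !case: ifPn; lra.
Qed.

(* Increments of the step are dominated by those of clamp01, whose translates
   sum to a clamp: hence a constant independent of the number m of terms. *)
Lemma sum_smooth_step_lip : exists2 L : R, 0 < L &
  forall (m : nat) (s t : R),
    \sum_(j < m) `|smooth_step (s - j%:R) - smooth_step (t - j%:R)|
      <= L * `|s - t|.
Proof.
have [L L0 HL] := smooth_step_lip; exists L => // m s t.
wlog st : s t / s <= t.
  move=> W; have [/W//|/ltW/W] := leP s t.
  rewrite distrC; apply: le_trans; rewrite le_eqVlt; apply/orP; left; apply/eqP.
  by apply: eq_bigr => j _; rewrite distrC.
rewrite distrC ger0_norm ?subr_ge0//.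
apply: (@le_trans _ _ (\sum_(j < m) L * (clamp01 (t - j%:R) - clamp01 (s - j%:R)))).
  apply: ler_sum => j _; rewrite distrC ger0_norm ?HL ?lerB//.
  by rewrite subr_ge0 smooth_step_nd// lerB.
rewrite -mulr_sumr ler_pM2l// sumrB !sum_clamp01.
have : 0 <= m%:R :> R by [].
by move: (m%:R : R) => r r0; rewrite !maxEle !minEle; do !case: ifPn; lra.
Qed.

End SmoothStep.

(** * Quasi-interpolation *)

Section PowR.
Context {R : realType}.
Implicit Types c s h b : R.

Lemma powRZ_le c s b : 1 <= c -> 0 <= s -> 0 < b < 1 ->
  (c * s) `^ b <= c * s `^ b.
Proof.
move=> c1 s0 /andP[b0 b1]; rewrite powRM// ?(le_trans ler01)//.
by rewrite ler_wpM2r ?powR_ge0// ler1_powR// ltW.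
Qed.

Lemma le_powR s h b : 0 < b < 1 -> 0 <= s -> s <= h -> s `^ b <= h `^ b.
Proof.
move=> /andP[b0 b1] s0 sh; apply: ge0_ler_powR => //; first exact: ltW.
by rewrite nnegrE (le_trans s0).
Qed.

(** Writing s = s^b s^(1-b), and likewise for h, reduces it to s^(1-b) <= h^(1-b). It turns a
    Lipschitz bound at scale h into a Hoelder bound. *)
Lemma powR_slope s h b : 0 < b < 1 -> 0 <= s -> s <= h ->
  s / h * h `^ b <= s `^ b.
Proof.
move=> /andP[b0 b1]; rewrite le_eqVlt => /orP[/eqP <- _|s0 sh].
  by rewrite !mul0r powR_ge0.
have h0 : 0 < h by exact: lt_le_trans sh.
rewrite mulrAC ler_pdivrMr//.
have Ex : forall x : R, 0 < x -> x = x `^ b * x `^ (1 - b).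
  move=> x x0; rewrite -powRD ?(gt_eqF x0) ?implybT//.
  by rewrite addrC subrK powRr1// ltW.
rewrite {1}(Ex _ s0) {2}(Ex _ h0) -mulrA ler_pM2l ?powR_gt0// mulrC.
rewrite ler_pM2l ?powR_gt0//; apply: ge0_ler_powR => //.
- by rewrite subr_ge0 ltW.
- by rewrite nnegrE ltW.
- by rewrite nnegrE ltW.
Qed.

End PowR.

(** * Increments of products of weights *)

Section ProductWeights.
Context {R : realType}.

(* Passing from a to b one factor at a time; unlike a bound by the sum of the
   |a i - b i|, this keeps the other factors, whose sum over cells is <= 1. *)
Lemma ler_norm_prodB n (a b : 'I_n -> R) :
  (forall i, 0 <= a i) -> (forall i, 0 <= b i) ->
  `|\prod_i a i - \prod_i b i| <=
  \sum_(i < n) \prod_(l < n) (if (l < i)%N then a l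
                  else if l == i then `|a l - b l| else b l).
Proof.
elim: n a b => [|n IH] a b a0 b0; first by rewrite !big_ord0 subrr normr0.
rewrite !big_ord_recl/=.
have -> : a ord0 * \prod_i a (lift ord0 i) - b ord0 * \prod_i b (lift ord0 i) =
    (a ord0 - b ord0) * \prod_i b (lift ord0 i) +
    a ord0 * (\prod_i a (lift ord0 i) - \prod_i b (lift ord0 i)) by ring.
apply: le_trans (ler_normD _ _) _; rewrite !normrM; apply: lerD.
  by rewrite [X in _ * X <= _]ger0_norm// prodr_ge0.
rewrite ger0_norm//; apply: le_trans (ler_wpM2l (a0 _) (IH _ _ _ _)) _ => //.
rewrite mulr_sumr; apply: ler_sum => i _; rewrite big_ord_recl/=.
by apply: ler_wpM2l.
Qed.

(** After the factor-by-factor bound, summing over [k] turns each product into a product of sums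
    over cells. Those of index other than [i] are at most 1, which leaves the variation in
    coordinate [i]. *)
Lemma sum_ler_norm_prodB n m (a b : 'I_n -> 'I_m -> R) :
  (forall i j, 0 <= a i j) -> (forall i j, 0 <= b i j) ->
  (forall i, \sum_j a i j <= 1) -> (forall i, \sum_j b i j <= 1) ->
  \sum_(k : {ffun 'I_n -> 'I_m}) `|\prod_i a i (k i) - \prod_i b i (k i)| <=
  \sum_i \sum_j `|a i j - b i j|.
Proof.
move=> a0 b0 a1 b1.
pose c (i l : 'I_n) (j : 'I_m) := if (l < i)%N then a l j
                else if l == i then `|a l j - b l j| else b l j.
apply: (@le_trans _ _ (\sum_(k : {ffun 'I_n -> 'I_m}) \sum_i \prod_l c i l (k l))).
  by apply: ler_sum => k _; exact: ler_norm_prodB.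
rewrite exchange_big/=; apply: ler_sum => i _.
rewrite -(bigA_distr_bigA (fun l j => c i l j)) (bigD1 i)//=.
rewrite {1}/c ltnn eqxx ler_piMr ?sumr_ge0//.
apply: prodr_ile1 => l li; rewrite /c (negbTE li); case: (l < i)%N.
  by rewrite sumr_ge0/= ?a1.
by rewrite sumr_ge0/= ?b1.
Qed.

End ProductWeights.

(** * Increments of the interpolation error *)

Section QuasiInterpolation.
Context {R : realType} {n : nat}.
Implicit Types (x y p q : 'rV[R]_n).

(** At distance s >= h the two errors are estimated separately: active nodes lie within 2h of [P x],
    so each error is at most 2 A s^b. At distance s < h the weights have total increment zero, so f
    (P x) can be subtracted from every value, and the Lipschitz bound on the weights multiplies the
    oscillation of [f] at scale 4h. *)
Lemma osc_quasi_interpolation (I : finType) (w : I -> 'rV[R]_n -> R)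
    (node : I -> 'rV[R]_n) (P : 'rV[R]_n -> 'rV[R]_n) (h C A b : R)
    (f : 'rV[R]_n -> R) :
  0 < h -> 0 <= C -> 0 <= A -> 0 < b < 1 ->
  (forall x y, `|P x - P y| <= 2 * `|x - y|) ->
  (forall i x, 0 <= w i x) ->
  (forall x, \sum_i w i x = 1) ->
  (forall i x, w i x != 0 -> `|node i - P x| <= 2 * h) ->
  (forall x y, \sum_i `|w i x - w i y| <= C * (`|x - y| / h)) ->
  (forall p q, `|p - q| <= 4 * h -> `|f p - f q| <= A * `|p - q| `^ b) ->
  forall x y,
    `|(\sum_i w i x * f (node i) - f (P x)) -
      (\sum_i w i y * f (node i) - f (P y))|
    <= (4 * C + 4) * A * `|x - y| `^ b.
Proof.
move=> h0 C0 A0 b01 lipP w0 w1 wnode wlip fA x y.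
set s := `|x - y|; have s0 : 0 <= s by exact: normr_ge0.
have ps0 : 0 <= s `^ b := powR_ge0 _ _.
have sumB z u : \sum_i w i z * f (node i) - u = \sum_i w i z * (f (node i) - u).
  rewrite [RHS](eq_bigr (fun i => w i z * f (node i) - w i z * u)); last first.
    by move=> i _; rewrite mulrBr.
  by rewrite sumrB -mulr_suml w1 mul1r.
have [hs|sh] := leP h s.
  have one z : `|\sum_i w i z * f (node i) - f (P z)| <= 2 * A * s `^ b.
    rewrite sumB (le_trans (ler_norm_sum _ _ _))//.
    rewrite -[leRHS]mul1r -[X in X * _](w1 z) mulr_suml; apply: ler_sum => i _.
    rewrite normrM ger0_norm//.
    have [->|wz] := eqVneq (w i z) 0; first by rewrite !mul0r.
    have nodeP : `|node i - P z| <= 4 * h.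
      by rewrite (le_trans (wnode _ _ wz))// ler_pM2r//; lra.
    apply: ler_wpM2l; first exact: w0.
    apply: le_trans (fA _ _ nodeP) _.
    rewrite (mulrC 2) -mulrA ler_wpM2l//.
    apply: (@le_trans _ _ ((2 * h) `^ b)); first by rewrite le_powR// wnode.
    have h12 : 1 <= 2 :> R by rewrite ler1n.
    apply: (le_trans (powRZ_le h12 (ltW h0) b01)).
    by rewrite ler_pM2l// le_powR// ltW.
  rewrite (le_trans (ler_normB _ _))// (le_trans (lerD (one x) (one y)))//.
  have : 0 <= C * A * s `^ b by rewrite !mulr_ge0.
  have : 0 <= A * s `^ b by rewrite mulr_ge0.
  lra.
have PP : `|P x - P y| <= 2 * s by exact: lipP.
have -> : (\sum_i w i x * f (node i) - f (P x)) -
      (\sum_i w i y * f (node i) - f (P y)) =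
   \sum_i (w i x - w i y) * (f (node i) - f (P x)) - (f (P x) - f (P y)).
  under [in RHS]eq_bigr do rewrite mulrBl.
  by rewrite sumrB -!sumB; ring.
rewrite (le_trans (ler_normB _ _))//.
have F1 : `|f (P x) - f (P y)| <= 2 * A * s `^ b.
  have PPh : `|P x - P y| <= 4 * h by lra.
  apply: le_trans (fA _ _ PPh) _.
  rewrite (mulrC 2) -mulrA; apply: ler_wpM2l => //.
  apply: le_trans (le_powR b01 _ PP) _ => //.
  by rewrite powRZ_le// ler1n.
have F2 : `|\sum_i (w i x - w i y) * (f (node i) - f (P x))| <=
    4 * C * A * s `^ b.
  rewrite (le_trans (ler_norm_sum _ _ _))//.
  apply: (@le_trans _ _ (\sum_i `|w i x - w i y| * (A * (4 * h `^ b)))).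
    apply: ler_sum => i _; rewrite normrM.
    have [->|wz] := eqVneq (w i x - w i y) 0; first by rewrite normr0 !mul0r.
    have nodeP : `|node i - P x| <= 4 * h.
      (* A node active only at [y] is within 2h of [P y], itself within 2h of [P x]: hence the range
         4h. *)
      have [wx|wx] := eqVneq (w i x) 0; last first.
        by rewrite (le_trans (wnode _ _ wx))//; lra.
      have wy : w i y != 0 by apply: contraNneq wz => ->; rewrite wx subrr.
      rewrite -(subrKA (P y)) (le_trans (ler_normD _ _))//.
      by have := wnode _ _ wy; rewrite distrC in PP; lra.
    apply: ler_wpM2l; first exact: normr_ge0.
    apply: le_trans (fA _ _ nodeP) _; apply: ler_wpM2l => //.
    apply: le_trans (le_powR b01 _ nodeP) _ => //.
    by rewrite powRZ_le// ?ler1n// ltW.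
  rewrite -mulr_suml.
  apply: le_trans (ler_wpM2r _ (wlip x y)) _.
    by rewrite !mulr_ge0// powR_ge0.
  have := powR_slope b01 s0 (ltW sh); rewrite -/s => H.
  have -> : C * (s / h) * (A * (4 * h `^ b)) = 4 * C * A * (s / h * h `^ b) by ring.
  by rewrite ler_wpM2l// !mulr_ge0.
apply: le_trans (lerD F2 F1) _.
have : 0 <= A * s `^ b by rewrite mulr_ge0.
lra.
Qed.

End QuasiInterpolation.

(** * A smooth partition of unity on a lattice *)

Section SmoothWeights.
Context {R : realType} {n : nat}.
Implicit Types (x y p q : 'rV[R]_n).

Lemma coord_ler_norm x i : `|x ord0 i| <= `|x|.
Proof.
rewrite [leRHS]/Num.Def.normr/= mx_normrE; apply/bigmax_geP; right => /=.
by exists (ord0, i).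
Qed.

Lemma mx_norm_ler x (c : R) :
  0 <= c -> (forall i, `|x ord0 i| <= c) -> `|x| <= c.
Proof.
move=> c0 xc; rewrite [leLHS]/Num.Def.normr/= mx_normrE bigmax_le// => -[i j] _.
by rewrite /= ord1.
Qed.

Lemma is_diff_coord i x :
  is_diff x (fun y => y ord0 i : R^o) (fun y => y ord0 i : R^o).
Proof.
have @f : {linear 'rV[R]_n -> R^o}.
  by exists (fun y => y ord0 i); do 2![eexists]; do ?[constructor];
     rewrite ?mxE// => ? *; rewrite ?mxE//; move=> ?; rewrite !mxE.
have fE : (fun y => y ord0 i : R^o) = f by [].
have fc : continuous f by exact: coord_continuous.
by rewrite fE; apply: DiffDef; [exact: linear_differentiable|exact: diff_lin].
Qed.

Lemma smooth_coord_comp (f : R^o -> R) (i : 'I_n) (a c : R) :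
  smooth f -> smooth (fun x => f (a * x ord0 i + c)).
Proof.
move=> sf k; apply: (@of_class_C_comp _ _ _ k f (fun x => a * x ord0 i + c : R^o)
  (fun x => a * x ord0 i : R^o) _ (sf k)) => x.
have ci := is_diff_coord i x.
have -> : (fun x => a * x ord0 i + c : R^o) =
    a \*: (fun x => x ord0 i : R^o) + cst (c : R^o) by [].
by apply: is_diff_eq; rewrite addr0.
Qed.

(** A bump on [j, j + 2] centred at j + 1; as a difference of consecutive translates it telescopes
    into a partition of unity. *)
Definition bump1 (j : nat) (s : R) : R :=
  smooth_step (s - j%:R) - smooth_step (s - j.+1%:R).

Lemma bump1_ge0 j s : 0 <= bump1 j s.
Proof. by rewrite subr_ge0 smooth_step_nd// lerB// ler_nat. Qed.

Lemma bump1_neq0 j s : bump1 j s != 0 -> `|s - j.+1%:R| <= 1.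
Proof.
apply: contraNT; rewrite -ltNge ltr_normr /bump1 -natr1 => /orP[] h.
  by rewrite !smooth_step_ge1 ?subrr//; lra.
by rewrite !smooth_step_le0 ?subrr//; lra.
Qed.

Lemma sum_bump1 m s :
  \sum_(j < m) bump1 j s = smooth_step s - smooth_step (s - m%:R).
Proof.
rewrite -(big_mkord xpredT (fun j => bump1 j s)).
rewrite (@telescope_sumr_eq _ 0%N m (fun j => - smooth_step (s - j%:R)))//.
  by rewrite opprK subr0 addrC.
by move=> j _; rewrite opprK addrC.
Qed.

Lemma sum_bump1_le1 m s : \sum_(j < m) bump1 j s <= 1.
Proof.
by rewrite sum_bump1 lerBlDr (le_trans (smooth_step_le1 _))// lerDl smooth_step_ge0.
Qed.

Lemma sum_bump1_eq1 m s : 1 <= s <= m%:R -> \sum_(j < m) bump1 j s = 1.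
Proof.
move=> /andP[s1 sm].
by rewrite sum_bump1 smooth_step_ge1// smooth_step_le0 ?subr0// subr_le0.
Qed.

Lemma sum_bump1_lip : exists2 L : R, 0 < L & forall (m : nat) (s t : R),
  \sum_(j < m) `|bump1 j s - bump1 j t| <= L * `|s - t|.
Proof.
have [L L0 HL] := @sum_smooth_step_lip R.
exists (2 * L); first by rewrite mulr_gt0.
move=> m s t.
apply: (@le_trans _ _ (
   \sum_(j < m) `|smooth_step (s - j%:R) - smooth_step (t - j%:R)| +
   \sum_(j < m) `|smooth_step (s - 1 - j%:R) - smooth_step (t - 1 - j%:R)|)).
  rewrite -big_split; apply: ler_sum => j _; rewrite /= /bump1.
  have E (u : R) : u - j.+1%:R = u - 1 - j%:R by rewrite -natr1; ring.
  rewrite !E; set c1 := smooth_step _; set c2 := smooth_step _.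
  set c3 := smooth_step _; set c4 := smooth_step _.
  by rewrite (_ : c1 - c2 - (c3 - c4) = (c1 - c3) - (c2 - c4)) ?ler_normB//; ring.
apply: le_trans (lerD (HL _ _ _) (HL _ _ _)) _.
rewrite (_ : s - 1 - (t - 1) = s - t); last by ring.
by lra.
Qed.

(** [C] is chosen before [P], [M] and [h], so it survives refinement of the mesh. That nodes active
    far out are 0 will later give compact support. *)
Lemma quasi_interpolation : exists2 C : R, 0 <= C &
  forall (P : 'rV[R]_n -> 'rV[R]_n) (M h : R),
  (forall x y, `|P x - P y| <= 2 * `|x - y|) ->
  (forall x, M < `|x| -> P x = 0) -> 0 < h ->
  exists (I : finType) (w : I -> 'rV[R]_n -> R) (node : I -> 'rV[R]_n) (M' : R),
  [/\ forall i, smooth (w i),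
      forall i x, M' < `|x| -> w i x != 0 -> node i = 0 &
      forall (A b : R) (f : 'rV[R]_n -> R), 0 <= A -> 0 < b < 1 ->
        (forall p q, `|p - q| <= 4 * h -> `|f p - f q| <= A * `|p - q| `^ b) ->
        forall x y,
          `|(\sum_i w i x * f (node i) - f (P x)) -
            (\sum_i w i y * f (node i) - f (P y))|
          <= C * A * `|x - y| `^ b].
Proof.
have [L L0 HL] := sum_bump1_lip.
(* Each of the [n] coordinates contributes [L]; the factor 2 pays for the extra index, whose weight
   varies no more than all the others together. *)
pose C1 : R := 2 * (n%:R * L).
have C10 : 0 <= C1 by rewrite !mulr_ge0// ltW.
exists (4 * C1 + 4) => [|P M h lipP P0 h0]; first by lra.
(* With the shift by [m], the rescaled coordinates of the ball of radius [M] fall into [1, 2m],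
   where the bumps sum to 1. *)
have [m hm] : exists m : nat, M / h + 1 <= m%:R.
  exists (Num.trunc `|M / h + 1|).+1; apply: le_trans (ler_norm _) _.
  by rewrite ltW// truncnS_gt.
pose N := (m + m)%N.
pose s x (i : 'I_n) : R := h^-1 * x ord0 i + m%:R.
pose u (k : {ffun 'I_n -> 'I_N}) x := \prod_i bump1 (k i) (s x i).
have u0 k x : 0 <= u k x by apply: prodr_ge0 => i _; exact: bump1_ge0.
have sumu x : \sum_k u k x = \prod_i \sum_(j < N) bump1 j (s x i).
  by rewrite (bigA_distr_bigA (fun i j => bump1 (nat_of_ord j) (s x i))).
have sumu1 x : \sum_k u k x <= 1.
  rewrite sumu; apply: prodr_ile1 => i _; rewrite sum_bump1_le1 andbT.
  by apply: sumr_ge0 => j _; exact: bump1_ge0.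
have sumuE x : `|x| <= M -> \sum_k u k x = 1.
  move=> xM; rewrite sumu big1// => i _; apply: sum_bump1_eq1.
  have := coord_ler_norm x i; move: xM; rewrite /s /N natrD => xM.
  move=> /le_trans /(_ xM); rewrite ler_norml => /andP[x1 x2].
  have {}x1 : - (M / h) <= h^-1 * x ord0 i.
    by rewrite [leRHS]mulrC -mulNr ler_pM2r ?invr_gt0.
  have {}x2 : h^-1 * x ord0 i <= M / h.
    by rewrite mulrC ler_pM2r ?invr_gt0.
  by apply/andP; split; lra.
(* The extra index carries the mass missing from the finite lattice; it only
   charges points where P vanishes. *)
pose I : finType := ({ffun 'I_n -> 'I_N} + unit)%type.
pose w (o : I) x := match o with inl k => u k x | inr _ => 1 - \sum_k u k x end.
pose cell (k : {ffun 'I_n -> 'I_N}) : 'rV[R]_n :=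
  \row_i (h * ((k i).+1%:R - m%:R)).
pose node (o : I) := match o with inl k => P (cell k) | inr _ => 0 end.
have cellP k x : u k x != 0 -> `|cell k - x| <= h.
  move=> ukx; apply: mx_norm_ler; first exact: ltW.
  move=> i; rewrite !mxE.
  have : bump1 (k i) (s x i) != 0.
    by apply: contraNneq ukx => z; rewrite /u (bigD1 i)//= z mul0r.
  move=> /bump1_neq0; rewrite /s => H.
  rewrite (_ : _ - _ = - (h * (h^-1 * x ord0 i + m%:R - (k i).+1%:R))).
    by rewrite normrN normrM gtr0_norm// ler_piMr// ltW.
  by field; rewrite gt_eqF.
have sw o : smooth (w o).
  have su k : smooth (u k).
    move=> l; apply: of_class_C_prod => i.
    apply: (@smooth_coord_comp (bump1 (k i)) i h^-1 m%:R) => {}l.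
    have st (c : R) : of_class_C l (fun t : R^o => smooth_step (t - c)).
      have dl (x : R^o) : is_diff x (fun x : R^o => x - c : R^o) id.
        have -> : (fun x : R^o => x - c : R^o) = id - cst c by [].
        by apply: is_diff_eq; rewrite subr0.
      exact: (@of_class_C_comp _ _ _ _ smooth_step _ _ dl (smooth_smooth_step l)).
    have -> : bump1 (k i) = (fun t : R^o => smooth_step (t - (k i)%:R)) \+
      (cst (-1) \* (fun t : R^o => smooth_step (t - (k i).+1%:R))).
      by apply/funext => t; rewrite /bump1 /= mulN1r.
    by apply: of_class_CD => //; apply: of_class_CM => //; exact: of_class_C_cst.
  case: o => [k|[]]; first exact: su.
  move=> l; have -> : w (inr tt) = cst 1 \+ (cst (-1) \* (fun x => \sum_k u k x)).
    by apply/funext => x; rewrite /w /= mulN1r.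
  apply: of_class_CD; first exact: of_class_C_cst.
  apply: of_class_CM; first exact: of_class_C_cst.
  by apply: of_class_C_sum => k; exact: su.
(* Lattice points have norm at most h m, and a cell weight lives within h of its lattice point. *)
exists I, w, node, (h * m%:R + h); split=> //.
- case=> [k|[]]//= x Mx ukx; exfalso; move: Mx; rewrite ltNge => /negP; apply.
  rewrite -(subrKC (cell k) x) (le_trans (ler_normD _ _))// lerD//; last first.
    by rewrite distrC cellP.
  apply: mx_norm_ler => [|i]; first by rewrite mulr_ge0// ltW.
  rewrite mxE normrM gtr0_norm// ler_pM2l// ler_norml.
  have : (k i < m + m)%N by exact: ltn_ord.
  rewrite -(ler_nat R) natrD -natr1 => k1.
  have k0 : 0 <= (k i)%:R :> R by [].
  by apply/andP; split; lra.
- move=> A b f A0 b01 fA; apply: (@osc_quasi_interpolation _ _ I w node P h) => //.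
  + by case=> [k|[]] x; [exact: u0|rewrite /w subr_ge0].
  + by move=> x; rewrite big_sumType/= [X in _ + X]big_const card_unit /= addr0 addrC subrK.
  + case=> [k|[]] x.
      by move=> ukx; rewrite (le_trans (lipP _ _))// ler_pM2l// cellP.
    rewrite /w/= => w0; rewrite P0 ?subrr ?normr0 ?mulr_ge0// ?ltW//.
    by rewrite ltNge; apply: contra w0 => /sumuE ->; rewrite subrr.
  + move=> x y; rewrite big_sumType/= [X in _ + X]big_const card_unit /= addr0.
    set T := \sum_k `|u k x - u k y|.
    have T2 : `|1 - \sum_k u k x - (1 - \sum_k u k y)| <= T.
      rewrite (_ : _ - _ - _ = - (\sum_k u k x - \sum_k u k y)); last by ring.
      by rewrite normrN -sumrB ler_norm_sum.
    suff : T <= n%:R * L * (`|x - y| / h) by rewrite /C1; lra.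
    apply: (@le_trans _ _ (\sum_i \sum_(j < N) `|bump1 j (s x i) - bump1 j (s y i)|)).
      apply: (@sum_ler_norm_prodB _ _ _ (fun i (j : 'I_N) => bump1 j (s x i))
        (fun i (j : 'I_N) => bump1 j (s y i))) => *;
      by rewrite ?bump1_ge0 ?sum_bump1_le1.
    rewrite -[n in n%:R]card_ord -mulrA mulr_natl -sumr_const; apply: ler_sum => i _.
    apply: le_trans (HL _ _ _) _; rewrite ler_pM2l//.
    rewrite (_ : s x i - s y i = h^-1 * ((x - y) ord0 i)); last first.
      by rewrite !mxE /s; ring.
    rewrite normrM gtr0_norm ?invr_gt0// mulrC ler_pM2r ?invr_gt0//.
    exact: coord_ler_norm.
Qed.

End SmoothWeights.

(** * Truncation *)

Section Truncation.
Context {R : realType} {n : nat}.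
Implicit Types (x y : 'rV[R]_n).

Lemma clamp01_sub (a b : R) : b <= a -> 0 <= clamp01 a - clamp01 b <= a - b.
Proof.
by rewrite /clamp01 !maxEle !minEle => ba; do !case: ifPn; lra.
Qed.

(* The logarithm gives s |lam'(s)| <= d at all scales, which is what makes
   x |-> lam(|x|) x a contraction where lam is small. *)
Definition log_cutoff (d N s : R) : R := clamp01 (1 - d * ln (s / N)).

(** This is ln (t/s) <= (t - s)/s, passed through the 1-Lipschitz clamp. *)
Lemma log_cutoff_lip (d N s t : R) : 0 < d -> 0 < N -> 0 < s -> s <= t ->
  s * `|log_cutoff d N s - log_cutoff d N t| <= d * (t - s).
Proof.
move=> d0 N0 s0 st; have t0 : 0 < t by exact: lt_le_trans st.
have sN : 0 < s / N by rewrite divr_gt0.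
have tN : 0 < t / N by rewrite divr_gt0.
have lnst : ln (s / N) <= ln (t / N) by rewrite ler_ln// ler_pM2r// invr_gt0.
have lnts : s * (ln (t / N) - ln (s / N)) <= t - s.
  rewrite -ln_div ?posrE// (_ : t / N / (s / N) = 1 + (t - s) / s); last first.
    by field; rewrite !gt_eqF.
  rewrite mulrC -ler_pdivlMr// le_ln1Dx// (lt_le_trans (ltrN10 R))//.
  by rewrite divr_ge0// ?subr_ge0// ltW.
have := @clamp01_sub (1 - d * ln (s / N)) (1 - d * ln (t / N)).
rewrite lerD2l lerN2 ler_pM2l// => /(_ lnst) /andP[c0 c1].
rewrite ger0_norm//.
apply: le_trans (ler_wpM2l (ltW s0) c1) _.
rewrite [leLHS](_ : _ = d * (s * (ln (t / N) - ln (s / N)))); last by ring.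
by rewrite ler_pM2l.
Qed.

Definition shrink (d N : R) x : 'rV[R]_n := log_cutoff d N `|x| *: x.

(** The difference of the cutoffs is put on the shorter vector, whose norm [log_cutoff_lip] absorbs;
    the other term carries the cutoff at the longer vector. *)
Lemma shrink_lip (d N : R) x y : 0 < d -> 0 < N -> `|x| <= `|y| ->
  `|shrink d N x - shrink d N y| <= (log_cutoff d N `|y| + d) * `|x - y|.
Proof.
move=> d0 N0 xy; rewrite /shrink.
set a := log_cutoff _ _ _; set b := log_cutoff _ _ _.
have b0 : 0 <= b by case/andP: (clamp01_itv (1 - d * ln (`|y| / N))).
have -> : a *: x - b *: y = b *: (x - y) + (a - b) *: x.
  by rewrite scalerBr scalerBl [RHS]addrC addrA subrK.
rewrite (le_trans (ler_normD _ _))// !normrZ (ger0_norm b0) mulrDl lerD2l.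
have [->|x0] := eqVneq x 0; first by rewrite normr0 mulr0 mulr_ge0// ltW.
rewrite mulrC (le_trans (log_cutoff_lip d0 N0 _ xy)) ?normr_gt0// ler_pM2l//.
by rewrite distrC (le_trans (ler_norm _))// ler_dist_dist.
Qed.

(** Take e = d/2 and N = K/e. If |y| > N but |P y| <= K, the cutoff at [y] is |P y| / |y| <= K/N =
    e, so the Lipschitz factor of [shrink_lip] is at most e + e = d. The cutoff reaches 0 at N
    exp(1/e). *)
Lemma truncation (K d : R) : 0 < K -> 0 < d <= 1 ->
  exists (P : 'rV[R]_n -> 'rV[R]_n) (M N : R), K <= N /\
  [/\ forall x y, `|P x - P y| <= 2 * `|x - y|,
      forall x, `|x| <= N -> P x = x,
      forall x, M < `|x| -> P x = 0 &
      forall x y, N < `|x| \/ N < `|y| ->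
        [\/ K < `|P x|, K < `|P y| | `|P x - P y| <= d * `|x - y|]].
Proof.
move=> K0 /andP[d0 d1].
pose e := d / 2; have e0 : 0 < e by rewrite divr_gt0.
have e1 : e <= 1 by rewrite /e; lra.
pose N := K / e; have N0 : 0 < N by rewrite divr_gt0.
exists (shrink e N), (N * expR e^-1), N; split.
  by rewrite ler_pdivlMr// ler_piMr// ltW.
split.
- move=> x y; wlog xy : x y / `|x| <= `|y|.
    by move=> W; case: (leP `|x| `|y|) => [/W//|/ltW/W]; rewrite distrC (distrC y).
  apply: le_trans (shrink_lip e0 N0 xy) _; apply: ler_wpM2r => //.
  by have /andP[_] := clamp01_itv (1 - e * ln (`|y| / N)); rewrite /log_cutoff; lra.
- move=> x xN; rewrite /shrink /log_cutoff /clamp01 (_ : Num.min _ _ = 1).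
    by rewrite (max_idPr ler01) scale1r.
  apply/min_idPl; rewrite lerDl oppr_ge0 pmulr_rle0// ln_le0//.
  by rewrite ler_pdivrMr// mul1r.
- move=> x xM; rewrite /shrink /log_cutoff /clamp01 (_ : Num.max _ _ = 0) ?scale0r//.
  apply/max_idPl; rewrite ge_min; apply/orP; right.
  rewrite subr_le0 -ler_pdivrMl// mulr1 -ler_expR lnK ?posrE.
    by rewrite ler_pdivlMr// mulrC ltW.
  by rewrite divr_gt0// (lt_trans _ xM)// mulr_gt0// expR_gt0.
- move=> x y; wlog xy : x y / `|x| <= `|y|.
    move=> W; case: (leP `|x| `|y|) => [/W//|/ltW yx H].
    have [| | |] := W y x yx; first by case: H; [right|left].
    + by move=> ?; constructor 2.
    + by move=> ?; constructor 1.
    + by rewrite distrC (distrC y) => ?; constructor 3.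
  move=> H; have {H} yN : N < `|y| by case: H => // /lt_le_trans; apply.
  have [?|PyK] := ltP K `|shrink e N y|; first by constructor 2.
  constructor 3; apply: le_trans (shrink_lip e0 N0 xy) _.
  apply: ler_wpM2r => //; suff : log_cutoff e N `|y| <= e by rewrite /e; lra.
  have /andP[c0 _] := clamp01_itv (1 - e * ln (`|y| / N)).
  move: PyK; rewrite /shrink normrZ ger0_norm// => h.
  rewrite -(ler_pM2r (lt_trans N0 yN)) (le_trans h)//.
  by rewrite mulrC -ler_pdivrMr// ltW.
Qed.

End Truncation.

(** * Approximation by test functions *)

Section CompactSupport.
Context {R : realType}.

Lemma compact_norm_le n (M : R) : compact [set x : 'rV[R]_n | `|x| <= M].
Proof.
apply: bounded_closed_compact.
  exists M; split; first exact: num_real.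
  by move=> c Mc x /= xM; rewrite (le_trans xM)// ltW.
rewrite (_ : mkset _ = (fun x : 'rV[R]_n => `|x|) @^-1` [set r | r <= M])//.
apply: (@closed_comp _ _ (fun x : 'rV[R]_n => `|x|)); last exact: closed_le.
by move=> x _; exact: norm_continuous.
Qed.

Lemma bounded_compactly_supported d1 d2 (f : 'rV[R]_d1 * 'rV[R]_d2 -> R)
    (M1 M2 : R) :
  (forall z, f z != 0 -> `|z.1| <= M1 /\ `|z.2| <= M2) ->
  compactly_supported f.
Proof.
move=> fM; pose B := [set x : 'rV[R]_d1 | `|x| <= M1] `*`
                     [set x : 'rV[R]_d2 | `|x| <= M2].
have cB : compact B by apply: compact_setX; exact: compact_norm_le.
have cl : closed B by apply: compact_closed => //; exact: norm_hausdorff.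
apply: (subclosed_compact _ cB); first exact: closed_closure.
by rewrite (closure_id B).1//; apply: closure_subset => z /fM.
Qed.

Lemma compactly_supported_bounded d1 d2 (f : 'rV[R]_d1 * 'rV[R]_d2 -> R) :
  compactly_supported f ->
  exists2 M : R, 0 < M & forall z, M < `|z| -> f z = 0.
Proof.
move=> /compact_bounded [M [_ Mf]].
exists (`|M| + 1); first by rewrite ltr_wpDl.
move=> z Mz; apply/eqP; apply: contraTT Mz => fz; rewrite -leNgt.
apply: (Mf (`|M| + 1)); first by rewrite (le_lt_trans (ler_norm M))// ltrDl.
exact: subset_closure.
Qed.

Lemma smooth_fst (V W : normedModType R) (f : V -> R) :
  smooth f -> smooth (fun z : V * W => f z.1).
Proof.
move=> sf k.
have dl (z : V * W) : is_diff z fst fst.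
  have fc : continuous (fst : V * W -> V) by move=> ?; exact: cvg_fst.
  by apply: DiffDef; [exact: linear_differentiable|exact: diff_lin].
exact: (@of_class_C_comp _ _ _ k f fst fst dl (sf k)).
Qed.

Lemma smooth_snd (V W : normedModType R) (f : W -> R) :
  smooth f -> smooth (fun z : V * W => f z.2).
Proof.
move=> sf k.
have dl (z : V * W) : is_diff z snd snd.
  have fc : continuous (snd : V * W -> W) by move=> ?; exact: cvg_snd.
  by apply: DiffDef; [exact: linear_differentiable|exact: diff_lin].
exact: (@of_class_C_comp _ _ _ k f snd snd dl (sf k)).
Qed.

End CompactSupport.

(** * Approximation of functions satisfying the vanishing condition *)

Section Approximation.
Context {R : realType} {d1 d2 : nat}.
Variables (b1 b2 : R).
Hypotheses (b1_01 : 0 < b1 < 1) (b2_01 : 0 < b2 < 1).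
Implicit Types (b : 'rV[R]_d1 * 'rV[R]_d2 -> R).

Definition mod2 (x1 y1 : 'rV[R]_d1) (x2 y2 : 'rV[R]_d2) : R :=
  `|x1 - y1| `^ b1 * `|x2 - y2| `^ b2.

Lemma mod2_ge0 x1 y1 x2 y2 : 0 <= mod2 x1 y1 x2 y2.
Proof. by rewrite mulr_ge0 ?powR_ge0. Qed.

Definition holder_bound b (C : R) := forall x1 y1 x2 y2,
  `|rect_diff b x1 y1 x2 y2| <= C * mod2 x1 y1 x2 y2.

Definition sup_near_or_far n (t : R) (x y : 'rV[R]_n) : Prop :=
  [\/ `|x - y| < t, t^-1 < `|x| | t^-1 < `|y|].

Definition vanishing b := forall e : R, 0 < e -> exists2 t : R, 0 < t &
  forall x1 y1 x2 y2, sup_near_or_far t x1 y1 \/ sup_near_or_far t x2 y2 ->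
    `|rect_diff b x1 y1 x2 y2| <= e * mod2 x1 y1 x2 y2.

(** Choose d with d^a = e / (C + e), which is at most 1. *)
Lemma exists_small_powR (C e a : R) : 0 <= C -> 0 < e -> 0 < a < 1 ->
  exists2 d : R, 0 < d <= 1 & C * d `^ a <= e.
Proof.
move=> C0 e0 /andP[a0 a1]; pose r := e / (C + e).
have Ce : 0 < C + e by rewrite ltr_wpDl.
have r0 : 0 < r by rewrite divr_gt0.
have r1 : r <= 1 by rewrite ler_pdivrMr// mul1r lerDr.
exists (r `^ a^-1).
  rewrite powR_gt0//=; suff : r `^ a^-1 <= 1 `^ a^-1 by rewrite powR1.
  apply: ge0_ler_powR.
  - by rewrite invr_ge0 ltW.
  - by rewrite nnegrE ltW.
  - by rewrite nnegrE.
  - exact: r1.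
rewrite -powRrM mulVf ?gt_eqF// powRr1 ?(ltW r0)// /r mulrA ler_pdivrMr//.
by rewrite mulrC ler_pM2l// lerDl ltW.
Qed.

Lemma mod2_le (x1 y1 u1 v1 : 'rV[R]_d1) (x2 y2 u2 v2 : 'rV[R]_d2) (a c : R) :
  0 <= a -> 0 <= c ->
  `|u1 - v1| <= a * `|x1 - y1| -> `|u2 - v2| <= c * `|x2 - y2| ->
  mod2 u1 v1 u2 v2 <= a `^ b1 * c `^ b2 * mod2 x1 y1 x2 y2.
Proof.
move=> a0 c0 h1 h2; rewrite /mod2 mulrACA -!powRM//.
by apply: ler_pM; rewrite ?powR_ge0// le_powR.
Qed.

Lemma powR_le_base (c a : R) : 0 < a < 1 -> 1 <= c -> c `^ a <= c.
Proof. by move=> /andP[_ a1] c1; rewrite ler1_powR// ltW. Qed.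

(** If some point lies beyond its radius [N1] or [N2], the two mixed differences are small
    separately: the original one since these radii are at least 1/t, the truncated one since an
    image is far out or one map contracts by [r1] or [r2]. Otherwise both maps fix all the points
    and the difference is 0. The factor 5 is 1 for the original plus 4 from two 2-Lipschitz maps. *)
Lemma truncation_error b (C e t : R) : 0 <= C -> holder_bound b C -> 0 < e ->
  0 < t ->
  (forall x1 y1 x2 y2, sup_near_or_far t x1 y1 \/ sup_near_or_far t x2 y2 ->
    `|rect_diff b x1 y1 x2 y2| <= e * mod2 x1 y1 x2 y2) ->
  exists (P1 : 'rV[R]_d1 -> 'rV[R]_d1) (P2 : 'rV[R]_d2 -> 'rV[R]_d2) (M1 M2 : R),
  [/\ forall x y, `|P1 x - P1 y| <= 2 * `|x - y|,
      forall x y, `|P2 x - P2 y| <= 2 * `|x - y|,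
      forall x, M1 < `|x| -> P1 x = 0,
      forall x, M2 < `|x| -> P2 x = 0 &
      forall x1 y1 x2 y2,
        `|rect_diff b x1 y1 x2 y2 -
          rect_diff b (P1 x1) (P1 y1) (P2 x2) (P2 y2)|
        <= 5 * e * mod2 x1 y1 x2 y2].
Proof.
move=> C0 bC e0 t0 bt.
have tV0 : 0 < t^-1 by rewrite invr_gt0.
have [r1 r1_01 hr1] := exists_small_powR C0 e0 b1_01.
have [r2 r2_01 hr2] := exists_small_powR C0 e0 b2_01.
have [P1 [M1 [N1 [tN1 [lip1 id1 z1 far1]]]]] := @truncation R d1 _ _ tV0 r1_01.
have [P2 [M2 [N2 [tN2 [lip2 id2 z2 far2]]]]] := @truncation R d2 _ _ tV0 r2_01.
exists P1, P2, M1, M2; split => // x1 y1 x2 y2.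
set D := mod2 x1 y1 x2 y2; have D0 : 0 <= D by exact: mod2_ge0.
have p21 := powR_le_base b1_01 (ler1n R 2).
have p22 := powR_le_base b2_01 (ler1n R 2).
have lip := mod2_le (ler0n R 2) (ler0n R 2) (lip1 x1 y1) (lip2 x2 y2).
have {lip} lip : mod2 (P1 x1) (P1 y1) (P2 x2) (P2 y2) <= 4 * D.
  apply: le_trans lip _; rewrite -/D ler_wpM2r//.
  by rewrite (_ : 4 = 2 * 2) ?ler_pM ?powR_ge0//; ring.
have near_far : sup_near_or_far t (P1 x1) (P1 y1) \/ sup_near_or_far t (P2 x2) (P2 y2) ->
   `|rect_diff b (P1 x1) (P1 y1) (P2 x2) (P2 y2)| <= 4 * e * D.
  move=> /bt h; apply: le_trans h _; rewrite (mulrC 4) -mulrA ler_pM2l//.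
have small1 : `|P1 x1 - P1 y1| <= r1 * `|x1 - y1| ->
   `|rect_diff b (P1 x1) (P1 y1) (P2 x2) (P2 y2)| <= 4 * e * D.
  have /andP[r10 _] := r1_01.
  move=> h; apply: le_trans (bC _ _ _ _) _.
  have := mod2_le (ltW r10) (ler0n R 2) h (lip2 x2 y2); rewrite -/D => h'.
  apply: le_trans (ler_wpM2l C0 h') _; rewrite mulrA ler_wpM2r// mulrA.
  apply: (@le_trans _ _ (e * 2)); last lra.
  by rewrite ler_pM// ?mulr_ge0// ?powR_ge0.
have small2 : `|P2 x2 - P2 y2| <= r2 * `|x2 - y2| ->
   `|rect_diff b (P1 x1) (P1 y1) (P2 x2) (P2 y2)| <= 4 * e * D.
  have /andP[r20 _] := r2_01.
  move=> h; apply: le_trans (bC _ _ _ _) _.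
  have := mod2_le (ler0n R 2) (ltW r20) (lip1 x1 y1) h; rewrite -/D => h'.
  apply: le_trans (ler_wpM2l C0 h') _; rewrite mulrA ler_wpM2r//.
  rewrite (mulrC (2 `^ b1)) mulrA.
  apply: (@le_trans _ _ (e * 2)); last lra.
  by rewrite ler_pM// ?mulr_ge0// ?powR_ge0.
have both : sup_near_or_far t x1 y1 \/ sup_near_or_far t x2 y2 ->
  `|rect_diff b (P1 x1) (P1 y1) (P2 x2) (P2 y2)| <= 4 * e * D ->
  `|rect_diff b x1 y1 x2 y2 - rect_diff b (P1 x1) (P1 y1) (P2 x2) (P2 y2)|
    <= 5 * e * D.
  move=> /bt h h'; rewrite (le_trans (ler_normB _ _))//.
  by rewrite (_ : 5 * e * D = e * D + 4 * e * D) ?lerD//; ring.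
have [H1|H1] := pselect (N1 < `|x1| \/ N1 < `|y1|).
  apply: both.
    left; case: H1 => H1; [apply: Or32|apply: Or33]; exact: le_lt_trans H1.
  case: (far1 x1 y1 H1) => [h|h|h]; last exact: small1.
    by apply: near_far; left; apply: Or32.
  by apply: near_far; left; apply: Or33.
have [H2|H2] := pselect (N2 < `|x2| \/ N2 < `|y2|).
  apply: both.
    right; case: H2 => H2; [apply: Or32|apply: Or33]; exact: le_lt_trans H2.
  case: (far2 x2 y2 H2) => [h|h|h]; last exact: small2.
    by apply: near_far; right; apply: Or32.
  by apply: near_far; right; apply: Or33.
have [x1N y1N] : `|x1| <= N1 /\ `|y1| <= N1.
  by split; rewrite leNgt; apply/negP => ?; apply: H1; [left|right].
have [x2N y2N] : `|x2| <= N2 /\ `|y2| <= N2.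
  by split; rewrite leNgt; apply/negP => ?; apply: H2; [left|right].
rewrite !id1// !id2// subrr normr0; apply: mulr_ge0 => //.
by rewrite mulr_ge0// ltW.
Qed.

(** [bt] vanishes when either argument is 0, yet has the mixed differences of [b]; the iterated form
    suits the one-variable estimates. *)
Lemma rect_diff_recenter b p q r r' :
  let bt := fun p r => rect_diff b p 0 r 0 in
  bt p r - bt p r' - (bt q r - bt q r') = rect_diff b p q r r'.
Proof. by rewrite /rect_diff /=; ring. Qed.

Lemma VC_approx b (C : R) : 0 <= C -> holder_bound b C -> vanishing b ->
  exists2 K : R, 0 <= K & forall e : R, 0 < e ->
    exists2 phi, Cc_infty phi & holder_bound (b \- phi) (K * e).
Proof.
move=> C0 bC bv.
have [C1 C10 H1] := @quasi_interpolation R d1.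
have [C2 C20 H2] := @quasi_interpolation R d2.
exists (5 + (C1 * (2 + C2) + 2 * C2)); first by rewrite !addr_ge0 ?mulr_ge0// addr_ge0.
move=> e e0; have [t t0 bt] := bv _ e0.
have [P1 [P2 [M1 [M2 [lip1 lip2 z1 z2 trunc]]]]] := truncation_error C0 bC e0 t0 bt.
(* Then 4h = t/2, so increments at distance at most 4h are in the range of [bt]. *)
pose h := t / 8; have h0 : 0 < h by rewrite divr_gt0.
have h4 : 4 * h < t by rewrite /h; lra.
have [I [w [p [M1' [sw supw osc1]]]]] := H1 P1 M1 h lip1 z1 h0.
have [J [v [q [M2' [sv supv osc2]]]]] := H2 P2 M2 h lip2 z2 h0.
(* Recentring makes nodes at 0 contribute nothing, whence the compact support of [phi]. *)
pose bz p q := rect_diff b p 0 q 0.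
pose phi (z : 'rV[R]_d1 * 'rV[R]_d2) :=
  \sum_i w i z.1 * (\sum_j v j z.2 * bz (p i) (q j)).
have bz0l r : bz 0 r = 0 by rewrite /bz /rect_diff; ring.
have bz0r r : bz r 0 = 0 by rewrite /bz /rect_diff; ring.
exists phi.
  split.
    move=> k; apply: of_class_C_sum => i.
    apply: of_class_CM; first exact: (@smooth_fst _ _ _ (w i) (sw i) k).
    apply: of_class_C_sum => j.
    by apply: of_class_CM; [exact: (@smooth_snd _ _ _ (v j) (sv j) k)|exact: of_class_C_cst].
  apply: (@bounded_compactly_supported _ _ _ _ M1' M2') => z phiz; split.
    rewrite leNgt; apply: contraNN phiz => Mz; apply/eqP.
    rewrite /phi big1// => i _; have [->|wi] := eqVneq (w i z.1) 0.
      by rewrite mul0r.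
    rewrite big1 ?mulr0// => j _.
    by rewrite (supw _ _ Mz wi) bz0l mulr0.
  rewrite leNgt; apply: contraNN phiz => Mz; apply/eqP.
  rewrite /phi big1// => i _; rewrite big1 ?mulr0// => j _.
  have [->|vj] := eqVneq (v j z.2) 0; first by rewrite mul0r.
  by rewrite (supv _ _ Mz vj) bz0r mulr0.
move=> x1 y1 x2 y2.
set D := mod2 x1 y1 x2 y2.
(* [S2] interpolates in the second variable only. Between [x2] and [y2], [F] is the increment of its
   error, [G] that of the truncated function and [H] that of [S2], all as functions of the first
   variable. *)
pose S2 r x := \sum_j v j x * bz r (q j).
pose F r := (S2 r x2 - bz r (P2 x2)) - (S2 r y2 - bz r (P2 y2)).
pose G r := bz r (P2 x2) - bz r (P2 y2).
pose H r := S2 r x2 - S2 r y2.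
have HE r : H r = F r + G r by rewrite /H /F /G; ring.
set s1 := `|x1 - y1| `^ b1; set s2 := `|x2 - y2| `^ b2.
have s10 : 0 <= s1 by exact: powR_ge0.
have s20 : 0 <= s2 by exact: powR_ge0.
have DE : D = s1 * s2 by [].
(* Valid for all [r] and [r']: the smallness comes from the second variable, where interpolation
   sees only increments at distance at most 4h. *)
have FB r r' : `|F r - F r'| <= C2 * e * `|r - r'| `^ b1 * s2.
  have := osc2 (e * `|r - r'| `^ b1) b2 (fun u => bz r u - bz r' u).
  rewrite mulr_ge0 ?powR_ge0 ?(ltW e0)// => /(_ isT b2_01) osc.
  have {}osc := osc _ x2 y2.
  rewrite (_ : C2 * e * _ * _ = C2 * (e * `|r - r'| `^ b1) * s2); last by rewrite !mulrA.
  have -> : F r - F r' =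
    (\sum_i v i x2 * (bz r (q i) - bz r' (q i)) - (bz r (P2 x2) - bz r' (P2 x2)) -
     (\sum_i v i y2 * (bz r (q i) - bz r' (q i)) - (bz r (P2 y2) - bz r' (P2 y2)))).
    have sumB x : \sum_i v i x * (bz r (q i) - bz r' (q i)) = S2 r x - S2 r' x.
      by rewrite -sumrB; apply: eq_bigr => i _; rewrite mulrBr.
    by rewrite !sumB /F; ring.
  apply: osc => u u' uu'.
  rewrite (_ : _ - _ = rect_diff b r r' u u'); last first.
    by rewrite -(rect_diff_recenter b) /bz; ring.
  rewrite -mulrA; apply: bt; right; apply: Or31; exact: (le_lt_trans uu' h4).
(* Here the smallness comes from the first variable instead. *)
have GB r r' : `|r - r'| <= 4 * h -> `|G r - G r'| <= 2 * e * `|r - r'| `^ b1 * s2.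
  move=> rr'; rewrite rect_diff_recenter.
  have near : sup_near_or_far t r r' by apply: Or31; exact: (le_lt_trans rr' h4).
  apply: le_trans (bt _ _ _ _ (or_introl near)) _.
  rewrite (mulrC 2) -!mulrA ler_pM2l// mulrCA ler_wpM2l ?powR_ge0//.
  apply: le_trans (le_powR b2_01 _ (lip2 _ _)) _ => //.
  by rewrite powRZ_le// ler1n.
have HB r r' : `|r - r'| <= 4 * h ->
    `|H r - H r'| <= (2 + C2) * e * s2 * `|r - r'| `^ b1.
  move=> rr'; rewrite !HE (_ : _ - _ = (F r - F r') + (G r - G r')); last by ring.
  rewrite (le_trans (ler_normD _ _))//.
  by apply: le_trans (lerD (FB _ _) (GB _ _ rr')) _; lra.
have A0 : 0 <= (2 + C2) * e * s2 by rewrite !mulr_ge0 ?addr_ge0// ltW.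
have nuH := osc1 _ b1 H A0 b1_01 HB x1 y1.
have F1 : `|F (P1 x1) - F (P1 y1)| <= 2 * C2 * e * D.
  apply: le_trans (FB _ _) _.
  rewrite (_ : 2 * C2 * e * D = C2 * e * s2 * (2 * s1)); last by rewrite DE; ring.
  rewrite mulrAC; apply: ler_wpM2l; first by rewrite !mulr_ge0// ltW.
  apply: le_trans (le_powR b1_01 _ (lip1 _ _)) _ => //.
  by rewrite powRZ_le// ler1n.
have phiE : rect_diff phi x1 y1 x2 y2 =
    \sum_i w i x1 * H (p i) - \sum_i w i y1 * H (p i).
  have sumH x : \sum_i w i x * H (p i) = phi (x, x2) - phi (x, y2).
    by rewrite -sumrB; apply: eq_bigr => i _; rewrite /H mulrBr.
  by rewrite !sumH /rect_diff; ring.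
(* Truncation error, minus the first-variable interpolation error of [H], minus the second-variable
   error at truncated points. Their constants 5, C1 (2 + C2) and 2 C2 add up to the one
   announced. *)
have -> : rect_diff (b \- phi) x1 y1 x2 y2 =
   (rect_diff b x1 y1 x2 y2 - rect_diff b (P1 x1) (P1 y1) (P2 x2) (P2 y2))
   - ((\sum_i w i x1 * H (p i) - H (P1 x1)) -
      (\sum_i w i y1 * H (p i) - H (P1 y1)) + (F (P1 x1) - F (P1 y1))).
  rewrite -(rect_diff_recenter b (P1 x1)) -/(bz _ _) -/(G _) -/(G _).
  have -> : rect_diff (b \- phi) x1 y1 x2 y2 =
    rect_diff b x1 y1 x2 y2 - rect_diff phi x1 y1 x2 y2.
    by rewrite /rect_diff /=; ring.
  by rewrite phiE !HE; ring.
rewrite (le_trans (ler_normB _ _))//.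
apply: le_trans (lerD (trunc _ _ _ _) (le_trans (ler_normD _ _) (lerD nuH F1))) _.
rewrite -/s1 -/D DE; lra.
Qed.

End Approximation.

(** * Test functions belong to VC *)

Section MeanValue.
Context {R : realType} {V : normedModType R}.
Implicit Types (f : V -> R) (x v z : V).

Lemma mvt_line f x v : (forall z, differentiable f z) ->
  exists z, f (x + v) - f x = 'D_v f z.
Proof.
move=> df; pose l (s : R^o) : V := s *: v + x.
have dl (s : R^o) : is_diff s l ( *:%R^~ v : R^o -> V).
  have -> : l = ( *:%R^~ v : R^o -> V) + cst x by [].
  by apply: is_diff_eq; rewrite addr0.
have dfl (s : R^o) : differentiable (f \o l) s.
  apply: differentiable_comp; last exact: df.
  exact: (@ex_diff _ _ _ _ _ _ _ (dl s)).
have [||c _] := @MVT_segment R (f \o l) (fun s => 'D_v f (l s)) 0 1 ler01.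
- move=> s _; apply: DeriveDef; first exact/derivable1_diffP.
  have dls : differentiable l s := @ex_diff _ _ _ _ _ _ _ (dl s).
  rewrite deriveE// diff_comp//=.
  by rewrite (@diff_val _ _ _ _ _ _ _ (dl s)) scale1r deriveE.
- apply: continuous_subspaceT => s; exact: differentiable_continuous.
by rewrite /= /l scale1r scale0r add0r subr0 mulr1 (addrC v) => ->; exists (c *: v + x).
Qed.

Lemma derive_translate f v (c : V) z :
  'D_v (fun y => f (y + c)) z = 'D_v f (z + c).
Proof.
rewrite /derive (_ : (fun h => _) =
  fun h : R => h^-1 *: ((f \o shift (z + c)) (h *: v) - f (z + c)))//.
by apply/funext => h /=; rewrite addrA.
Qed.

Lemma differentiable_translate f (c : V) z :
  (forall y, differentiable f y) -> differentiable (fun y => f (y + c)) z.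
Proof.
move=> df; have dl (y : V) : is_diff y (fun y => y + c) id.
  have -> : (fun y => y + c) = id + cst c by [].
  by apply: is_diff_eq; rewrite addr0.
by apply: (@differentiable_comp _ _ _ _ (fun y => y + c) f).
Qed.

Lemma derive_lin n (a : 'I_n -> R) (e : 'I_n -> V) f z : differentiable f z ->
  'D_(\sum_i a i *: e i) f z = \sum_i a i * 'D_(e i) f z.
Proof.
move=> df; rewrite deriveE// linear_sum; apply: eq_bigr => i _.
by rewrite linearZ /= deriveE.
Qed.

Lemma derive_eq0_far f (M : R) v z : (forall z, M < `|z| -> f z = 0) ->
  M < `|z| -> 'D_v f z = 0.
Proof.
move=> f0 Mz; rewrite -(derive_cst (0 : R) z v); apply: near_eq_derive.
have : \forall y \near z, M < `|y|.
  by apply: (cvgr_gt `|z|) => //; exact: cvg_norm.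
by apply: filterS => y; exact: f0.
Qed.

End MeanValue.

(** * Mixed differences of test functions *)

Section TestFunctions.
Context {R : realType} {d1 d2 : nat}.
Notation V := ('rV[R]_d1 * 'rV[R]_d2)%type.
Implicit Types (f g phi : V -> R).

Lemma continuous_compactly_bounded f (M : R) : continuous f ->
  (forall z, M < `|z| -> f z = 0) -> exists2 B : R, 0 <= B & forall z, `|f z| <= B.
Proof.
move=> cf f0.
pose K := [set x : 'rV[R]_d1 | `|x| <= M] `*` [set x : 'rV[R]_d2 | `|x| <= M].
have cK : compact K by apply: compact_setX; exact: compact_norm_le.
have : compact (f @` K).
  by apply: continuous_compact => //; exact: continuous_subspaceT.
move=> /compact_bounded[B [_ HB]]; exists (`|B| + 1) => // z.
have [zM|zM] := ltP M `|z|; first by rewrite f0// normr0.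
apply: (HB (`|B| + 1)); first by rewrite (le_lt_trans (ler_norm B))// ltrDl.
exists z => //; move: zM; rewrite prod_normE/= ge_max => /andP[? ?]; exact: conj.
Qed.

Lemma norm_pairl (x1 : 'rV[R]_d1) (x2 : 'rV[R]_d2) : `|x1| <= `|(x1, x2) : V|.
Proof. by rewrite prod_normE/= le_max lexx. Qed.

Lemma norm_pairr (x1 : 'rV[R]_d1) (x2 : 'rV[R]_d2) : `|x2| <= `|(x1, x2) : V|.
Proof. by rewrite prod_normE/= le_max lexx orbT. Qed.

(** The mean value theorem is applied in the first variable to the increment of [phi] in the second,
    then in the second variable to each partial derivative. The mixed second derivatives are
    continuous and vanish far out, hence are bounded. *)
Lemma rect_diff_le_prod phi : of_class_C 2 phi -> compactly_supported phi ->
  exists2 C : R, 0 <= C & forall x1 y1 x2 y2,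
    `|rect_diff phi x1 y1 x2 y2| <= C * (`|x1 - y1| * `|x2 - y2|).
Proof.
move=> C2 /compactly_supported_bounded[M _ phi0].
have [dphi Dphi] := C2.
pose e1 (i : 'I_d1) : V := (delta_mx ord0 i, 0).
pose e2 (i : 'I_d2) : V := (0, delta_mx ord0 i).
have e1E (w : 'rV[R]_d1) : (w, 0) = \sum_i w ord0 i *: e1 i.
  rewrite {1}(row_sum_delta w) /e1.
  have F (a : 'I_d1 -> R) : \sum_i a i *: ((delta_mx ord0 i, 0) : V) =
     (\sum_i a i *: delta_mx ord0 i, 0).
    apply: (big_ind2 (fun (x : V) y => x = (y, 0))) => //.
      by move=> ? ? ? ? -> ->; congr pair; rewrite addr0.
    by move=> i _; congr pair; rewrite scaler0.
  by rewrite F.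
have e2E (w : 'rV[R]_d2) : (0, w) = \sum_i w ord0 i *: e2 i.
  rewrite {1}(row_sum_delta w) /e2.
  have F (a : 'I_d2 -> R) : \sum_i a i *: ((0, delta_mx ord0 i) : V) =
     (0, \sum_i a i *: delta_mx ord0 i).
    apply: (big_ind2 (fun (x : V) y => x = (0, y))) => //.
      by move=> ? ? ? ? -> ->; congr pair; rewrite addr0.
    by move=> i _; congr pair; rewrite scaler0.
  by rewrite F.
pose g i j := 'D_(e2 j) ('D_(e1 i) phi).
have gB (ij : 'I_d1 * 'I_d2) :
    exists B : R, 0 <= B /\ forall z, `|g ij.1 ij.2 z| <= B.
  have [|z Mz|B B0 HB] := @continuous_compactly_bounded (g ij.1 ij.2) M.
  - exact: (Dphi (e1 ij.1)).2.
  - by apply: (@derive_eq0_far _ _ _ M) => // y; exact: derive_eq0_far.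
  - by exists B.
have [B HB] := choice gB.
exists (\sum_i \sum_j B (i, j)).
  by apply: sumr_ge0 => i _; apply: sumr_ge0 => j _; case: (HB (i, j)).
move=> x1 y1 x2 y2; set w := x1 - y1; set u := x2 - y2.
pose F (z : V) := phi (z + (0, u)) - phi z.
have dsh (z : V) : differentiable (fun z => phi (z + (0, u))) z.
  exact: differentiable_translate.
have dF z : differentiable F z by apply: differentiableB.
have -> : rect_diff phi x1 y1 x2 y2 = F ((y1, y2) + (w, 0)) - F (y1, y2).
  have E1 : (y1, y2) + (w, 0) = (x1, y2) :> V.
    by congr pair; rewrite ?addr0// addrC subrK.
  have E2 (x : 'rV[R]_d1) : (x, y2) + (0, u) = (x, x2) :> V.
    by congr pair; rewrite ?addr0// addrC subrK.
  by rewrite /F E1 !E2 /rect_diff; ring.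
have [z ->] := mvt_line (y1, y2) (w, 0) dF.
have -> : 'D_(w, 0) F z = \sum_i w ord0 i *
   ('D_(e1 i) phi (z + (0, u)) - 'D_(e1 i) phi z).
  rewrite /F deriveB; [|exact: diff_derivable|exact: diff_derivable].
  rewrite derive_translate e1E !derive_lin// -sumrB.
  by apply: eq_bigr => i _; rewrite mulrBr.
(* The bound is termwise in [i] because the second intermediate point depends on [i]. *)
apply: le_trans (ler_norm_sum _ _ _) _; rewrite mulr_suml; apply: ler_sum => i _.
have [z' ->] := mvt_line z (0, u) (Dphi (e1 i)).1.
rewrite e2E derive_lin; last exact: (Dphi (e1 i)).1.
rewrite normrM mulr_suml.
apply: (@le_trans _ _ (`|w| * (\sum_j B (i, j) * `|u|))).
  apply: ler_pM => //; first exact: coord_ler_norm.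
  apply: le_trans (ler_norm_sum _ _ _) _; apply: ler_sum => j _.
  rewrite normrM mulrC; apply: ler_pM => //; last exact: coord_ler_norm.
  by case: (HB (i, j)) => _; exact.
rewrite mulr_sumr le_eqVlt; apply/orP; left; apply/eqP; apply: eq_bigr => j _.
by ring.
Qed.

End TestFunctions.

(** * A localised and capped modulus *)

Section LocalModulus.
Context {R : realType} {n : nat}.
Implicit Types (x y : 'rV[R]_n) (M b : R).

Definition clampv (A : R) x : 'rV[R]_n :=
  \row_i Num.max (- A) (Num.min A (x ord0 i)).

Lemma clampv_lip A x y : `|clampv A x - clampv A y| <= `|x - y|.
Proof.
apply: mx_norm_ler => // i; rewrite !mxE; have := coord_ler_norm (x - y) i.
rewrite !mxE; apply: le_trans; move: (x ord0 i) (y ord0 i) => r s.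
rewrite !maxEle !minEle ler_norml.
by case: (ger0P (r - s)); do !case: ifPn; lra.
Qed.

Lemma clampv_le A x : 0 <= A -> `|clampv A x| <= A.
Proof.
move=> A0; apply: mx_norm_ler => // i; rewrite mxE ler_norml.
by rewrite le_max lexx/= ge_max ge_min lexx andbT; lra.
Qed.

Lemma clampv_id A x : `|x| <= A -> clampv A x = x.
Proof.
move=> xA; apply/rowP => i; rewrite mxE.
have := le_trans (coord_ler_norm x i) xA; rewrite ler_norml => /andP[h1 h2].
by rewrite (min_idPr h2) (max_idPr h1).
Qed.

(** Used with A = M + 1: an outer point, once clamped, still has norm above [M], where the test
    function vanishes. *)
Lemma clampv_far A x : 0 <= A -> A < `|x| -> A <= `|clampv A x|.
Proof.
move=> A0; rewrite leNgt => Ax; apply: contraTN Ax => Ac; rewrite -leNgt.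
apply: mx_norm_ler => // i; have := le_lt_trans (coord_ler_norm (clampv A x) i) Ac.
rewrite mxE ltr_norml ler_norml.
by rewrite !maxEle !minEle; do !case: ifPn; lra.
Qed.

Lemma ler_powRB (s t b : R) : 0 < b < 1 -> 0 <= s <= t ->
  s <= t `^ (1 - b) * s `^ b.
Proof.
move=> /andP[b0 b1] /andP[s0 st].
have [->|sn0] := eqVneq s 0; first by rewrite mulr_ge0 ?powR_ge0.
have E : s = s `^ (1 - b) * s `^ b.
  by rewrite -powRD ?sn0 ?implybT// subrK powRr1.
rewrite {1}E ler_wpM2r ?powR_ge0//; apply: ge0_ler_powR => //.
  by rewrite subr_ge0 ltW.
by rewrite nnegrE (le_trans s0).
Qed.

(** What one variable contributes to the mixed difference of a function supported in the ball of
    radius [M]; the cap bounds the distance between points clamped at M + 1. *)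
Definition loc_mod M x y : R :=
  if (`|x| <= M) || (`|y| <= M) then Num.min `|x - y| (2 * (M + 1)) else 0.

Lemma loc_mod_ge0 M x y : 0 <= M -> 0 <= loc_mod M x y.
Proof.
move=> M0; rewrite /loc_mod; case: ifP => // _.
by rewrite le_min normr_ge0 mulr_ge0// addr_ge0.
Qed.

(** Write m = m^(1-b) m^b; the cap bounds the first factor and the distance the second. *)
Lemma loc_mod_le M x y b : 0 <= M -> 0 < b < 1 ->
  loc_mod M x y <= (2 * (M + 1)) `^ (1 - b) * `|x - y| `^ b.
Proof.
move=> M0 b01; rewrite /loc_mod; case: ifP => _; last first.
  by rewrite mulr_ge0 ?powR_ge0.
set A := 2 * (M + 1); have A0 : 0 <= A by rewrite mulr_ge0// addr_ge0.
set m := Num.min _ _.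
have m0 : 0 <= m by rewrite /m le_min normr_ge0.
have mA : m <= A by rewrite /m ge_min lexx orbT.
apply: le_trans (ler_powRB b01 (introT andP (conj m0 mA))) _.
by rewrite ler_wpM2l ?powR_ge0// le_powR// /m ge_min lexx.
Qed.

(** For close points, |x - y| <= r with r^(1-b) <= e suffices. If one point has norm above M + S,
    either the other is outside the ball too and the modulus is 0, or the distance is at least S,
    where e S^b equals the cap. Allowing every [t] up to [t0] lets the two variables share one
    [t]. *)
Lemma loc_mod_vanish M b e : 0 <= M -> 0 < b < 1 -> 0 < e ->
  exists2 t0 : R, 0 < t0 & forall t x y, 0 < t <= t0 ->
    sup_near_or_far t x y -> loc_mod M x y <= e * `|x - y| `^ b.
Proof.
move=> M0 b01 e0; have /andP[b0 b1] := b01.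
pose A := 2 * (M + 1); have A0 : 0 < A by rewrite mulr_gt0// ltr_wpDl.
have b'01 : 0 < 1 - b < 1 by apply/andP; split; lra.
have [r /andP[r0 _]] := exists_small_powR (@ler01 R) e0 b'01.
rewrite mul1r => re.
pose S := (A / e) `^ b^-1.
have S0 : 0 < S by rewrite powR_gt0// divr_gt0.
have SA : A = e * S `^ b.
  rewrite /S -powRrM mulVf ?gt_eqF// powRr1 ?divr_ge0 ?ltW//.
  by rewrite mulrCA divff ?mulr1// gt_eqF.
have MS0 : 0 < M + S by rewrite ltr_wpDl.
exists (Num.min r (M + S)^-1); first by rewrite lt_min r0 invr_gt0.
move=> t x y; rewrite le_min => /andP[t0 /andP[tr tMS]].
have far : M + S <= t^-1.
  by rewrite -[leLHS]invrK lef_pV2 ?posrE ?invr_gt0.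
have rhs0 : 0 <= e * `|x - y| `^ b by rewrite mulr_ge0 ?powR_ge0// ltW.
have big : S <= `|x - y| -> loc_mod M x y <= e * `|x - y| `^ b.
  move=> Sxy; apply: (@le_trans _ _ A).
    rewrite /loc_mod; case: ifP => _; last exact: ltW.
    by rewrite ge_min lexx orbT.
  by rewrite SA ler_pM2l// le_powR// ltW.
case => h.
- rewrite /loc_mod; case: ifP => // _; apply: (@le_trans _ _ `|x - y|).
    by rewrite ge_min lexx.
  have xyr : 0 <= `|x - y| <= r by rewrite normr_ge0/= (le_trans (ltW h)).
  apply: le_trans (ler_powRB b01 xyr) _.
  by rewrite ler_wpM2r ?powR_ge0.
- have [yM|yM] := leP `|y| M.
    apply: big; have := lerB_dist x y; lra.
  have xM : M < `|x| by lra.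
  by rewrite /loc_mod ifF// !leNgt xM yM.
- have [xM|xM] := leP `|x| M.
    apply: big; have := lerB_dist y x; rewrite (distrC y); lra.
  have yM : M < `|y| by lra.
  by rewrite /loc_mod ifF// !leNgt xM yM.
Qed.

End LocalModulus.

(** * Hoelder bound and vanishing for test functions *)

Section TestFunctionsVanish.
Context {R : realType} {d1 d2 : nat}.
Variables (b1 b2 : R).
Hypotheses (b1_01 : 0 < b1 < 1) (b2_01 : 0 < b2 < 1).
Implicit Types (phi : 'rV[R]_d1 * 'rV[R]_d2 -> R).

(** The product form separates the variables, so that smallness in either one is enough. *)
Lemma Cc_infty_loc_mod phi : Cc_infty phi ->
  exists2 C : R, 0 <= C & exists2 M : R, 0 <= M & forall x1 y1 x2 y2,
    `|rect_diff phi x1 y1 x2 y2| <= C * (loc_mod M x1 y1 * loc_mod M x2 y2).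
Proof.
move=> [sphi cphi]; have [C C0 HC] := rect_diff_le_prod (sphi 2%N) cphi.
have [M M0 phi0] := compactly_supported_bounded cphi.
exists C => //; exists M; first exact: ltW.
have A0 : 0 <= M + 1 by rewrite addr_ge0// ltW.
(* phi is unchanged by clamping at M + 1, and clamped points are at distance at
   most 2 (M + 1). *)
pose c1 := @clampv R d1 (M + 1); pose c2 := @clampv R d2 (M + 1).
have phic x1 x2 : phi (x1, x2) = phi (c1 x1, c2 x2).
  have [h1|h1] := leP `|x1| (M + 1); last first.
    rewrite !phi0//.
      rewrite (lt_le_trans _ (norm_pairl _ _))//.
      by rewrite (lt_le_trans _ (clampv_far A0 h1))// ltrDl.
    by rewrite (lt_le_trans _ (norm_pairl _ _))// (lt_trans _ h1)// ltrDl.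
  have [h2|h2] := leP `|x2| (M + 1); last first.
    rewrite !phi0//.
      rewrite (lt_le_trans _ (norm_pairr _ _))//.
      by rewrite (lt_le_trans _ (clampv_far A0 h2))// ltrDl.
    by rewrite (lt_le_trans _ (norm_pairr _ _))// (lt_trans _ h2)// ltrDl.
  by rewrite /c1 /c2 !clampv_id.
have clamp_min n (x y : 'rV[R]_n) :
   `|clampv (M + 1) x - clampv (M + 1) y| <= Num.min `|x - y| (2 * (M + 1)).
  rewrite le_min clampv_lip/= (le_trans (ler_normB _ _))//.
  by have := clampv_le x A0; have := clampv_le y A0; lra.
move=> x1 y1 x2 y2; rewrite /loc_mod.
have [h1|] := boolP ((`|x1| <= M) || (`|y1| <= M)); last first.
  rewrite negb_or -!ltNge => /andP[h1 h1'].
  rewrite mul0r mulr0 /rect_diff.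
  have z1 x : phi (x1, x) = 0 by rewrite phi0// (lt_le_trans h1)// norm_pairl.
  have z2 x : phi (y1, x) = 0 by rewrite phi0// (lt_le_trans h1')// norm_pairl.
  by rewrite !z1 !z2 !subr0 addr0 normr0.
have [h2|] := boolP ((`|x2| <= M) || (`|y2| <= M)); last first.
  rewrite negb_or -!ltNge => /andP[h2 h2'].
  rewrite mulr0 mulr0 /rect_diff.
  have z1 x : phi (x, x2) = 0 by rewrite phi0// (lt_le_trans h2)// norm_pairr.
  have z2 x : phi (x, y2) = 0 by rewrite phi0// (lt_le_trans h2')// norm_pairr.
  by rewrite !z1 !z2 !subr0 addr0 normr0.
have -> : rect_diff phi x1 y1 x2 y2 = rect_diff phi (c1 x1) (c1 y1) (c2 x2) (c2 y2).
  by rewrite /rect_diff (phic x1 x2) (phic x1 y2) (phic y1 x2) (phic y1 y2).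
by apply: le_trans (HC _ _ _ _) _; rewrite ler_wpM2l// ler_pM.
Qed.

Lemma Cc_infty_holder_vanishing phi : Cc_infty phi ->
  (exists2 C : R, 0 <= C & holder_bound b1 b2 phi C) /\ vanishing b1 b2 phi.
Proof.
move=> /Cc_infty_loc_mod[C C0 [M M0 HC]].
pose A := 2 * (M + 1).
pose K1 := A `^ (1 - b1); pose K2 := A `^ (1 - b2).
have K10 : 0 <= K1 by exact: powR_ge0.
have K20 : 0 <= K2 by exact: powR_ge0.
have w1 (x y : 'rV[R]_d1) := loc_mod_le x y M0 b1_01.
have w2 (x y : 'rV[R]_d2) := loc_mod_le x y M0 b2_01.
rewrite -/A -/K1 in w1; rewrite -/A -/K2 in w2.
split.
  exists (C * (K1 * K2)); first by rewrite !mulr_ge0.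
  move=> x1 y1 x2 y2; apply: le_trans (HC _ _ _ _) _.
  rewrite -mulrA ler_wpM2l// /mod2 mulrACA.
  by apply: ler_pM; rewrite ?loc_mod_ge0.
move=> e e0.
(* The smallness asked of one variable is divided by [C] times the Hoelder constant of the other;
   adding 1 keeps the divisor positive. *)
have CK2 : 0 < C * K2 + 1 by rewrite ltr_wpDl// mulr_ge0.
have CK1 : 0 < C * K1 + 1 by rewrite ltr_wpDl// mulr_ge0.
have [t1 t10 H1] := @loc_mod_vanish R d1 M b1 _ M0 b1_01 (divr_gt0 e0 CK2).
have [t2 t20 H2] := @loc_mod_vanish R d2 M b2 _ M0 b2_01 (divr_gt0 e0 CK1).
have absorb (K : R) : 0 <= K -> C * (e / (C * K + 1) * K) <= e.
  move=> K0; rewrite (_ : C * _ = (C * K) * e / (C * K + 1)); last by ring.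
  have CK : 0 <= C * K by rewrite mulr_ge0.
  by rewrite ler_pdivrMr ?ltr_wpDl// mulrC ler_pM2l// lerDl.
exists (Num.min t1 t2); first by rewrite lt_min t10.
move=> x1 y1 x2 y2.
case=> h; apply: le_trans (HC _ _ _ _) _.
- have {}h : loc_mod M x1 y1 <= e / (C * K2 + 1) * `|x1 - y1| `^ b1.
    by apply: H1 h; rewrite lt_min t10 t20 ge_min lexx.
  apply: (@le_trans _ _ (C * (e / (C * K2 + 1) * K2 * mod2 b1 b2 x1 y1 x2 y2))).
    rewrite ler_wpM2l// /mod2 mulrACA.
    by apply: ler_pM; rewrite ?loc_mod_ge0.
  by rewrite mulrA ler_wpM2r ?mod2_ge0// absorb.
- have {}h : loc_mod M x2 y2 <= e / (C * K1 + 1) * `|x2 - y2| `^ b2.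
    by apply: H2 h; rewrite lt_min t10 t20 ge_min lexx orbT.
  apply: (@le_trans _ _ (C * (e / (C * K1 + 1) * K1 * mod2 b1 b2 x1 y1 x2 y2))).
    rewrite ler_wpM2l// /mod2 (mulrC _ K1) mulrACA.
    by apply: ler_pM; rewrite ?loc_mod_ge0.
  by rewrite mulrA ler_wpM2r ?mod2_ge0// absorb.
Qed.

End TestFunctionsVanish.

(** * Back to the Euclidean norm *)

Section Euclidean.
Context {R : realType} {n : nat}.
Implicit Types (x y : 'rV[R]_n).

Lemma enorm_ge0 x : 0 <= enorm x.
Proof. exact: sqrtr_ge0. Qed.

Lemma norm_le_enorm x : `|x| <= enorm x.
Proof.
apply: mx_norm_ler => [|i]; first exact: enorm_ge0.
rewrite -sqrtr_sqr ler_wsqrtr// (bigD1 i)//= lerDl.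
by apply: sumr_ge0 => j _; exact: sqr_ge0.
Qed.

(** The sum of squares is at most n |x|^2 <= (n |x|)^2; the crude factor n avoids a root. *)
Lemma enorm_le_norm x : (0 < n)%N -> enorm x <= n%:R * `|x|.
Proof.
move=> n0; rewrite -[leRHS]ger0_norm ?mulr_ge0// -sqrtr_sqr ler_wsqrtr//.
apply: (@le_trans _ _ (\sum_(i < n) `|x| ^+ 2)).
  apply: ler_sum => i _; rewrite -[leLHS]real_normK ?num_real//.
  by rewrite ler_sqr ?nnegrE// coord_ler_norm.
rewrite sumr_const card_ord -[leLHS]mulr_natl exprMn ler_wpM2r ?sqr_ge0//.
by rewrite expr2 ler_peMl// ler1n.
Qed.

End Euclidean.

(** * Transfer of VC and of the closure to the max norm *)

Section EuclideanToSup.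
Context {R : realType} {d1 d2 : nat}.
Variables (b1 b2 : R).
Hypotheses (b1_01 : 0 < b1 < 1) (b2_01 : 0 < b2 < 1).
Hypotheses (d1_gt0 : (0 < d1)%N) (d2_gt0 : (0 < d2)%N).
Implicit Types (b phi : 'rV[R]_d1 * 'rV[R]_d2 -> R).

(** One constant above 1 and both dimensions serves for the comparison of moduli and for the
    rescaling of [t]. *)
Let dd : R := d1%:R * d2%:R.

Let dd_ge1 : 1 <= dd.
Proof. by rewrite /dd -natrM ler1n muln_gt0 d1_gt0. Qed.

Let dd_gt0 : 0 < dd. Proof. exact: lt_le_trans dd_ge1. Qed.

Definition emod2 (x1 y1 : 'rV[R]_d1) (x2 y2 : 'rV[R]_d2) : R :=
  enorm (x1 - y1) `^ b1 * enorm (x2 - y2) `^ b2.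

Lemma mod2_le_emod2 x1 y1 x2 y2 : mod2 b1 b2 x1 y1 x2 y2 <= emod2 x1 y1 x2 y2.
Proof.
by apply: ler_pM; rewrite ?powR_ge0// le_powR// norm_le_enorm.
Qed.

Lemma emod2_le_mod2 x1 y1 x2 y2 :
  emod2 x1 y1 x2 y2 <= dd * mod2 b1 b2 x1 y1 x2 y2.
Proof.
rewrite /dd /mod2 mulrACA; apply: ler_pM; rewrite ?powR_ge0//.
  apply: le_trans (le_powR b1_01 (enorm_ge0 _) (enorm_le_norm _ d1_gt0)) _.
  by rewrite powRZ_le// ler1n.
apply: le_trans (le_powR b2_01 (enorm_ge0 _) (enorm_le_norm _ d2_gt0)) _.
by rewrite powRZ_le// ler1n.
Qed.

Lemma enorm_gt0 n (x y : 'rV[R]_n) : x != y -> 0 < enorm (x - y).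
Proof. by move=> xy; rewrite (lt_le_trans _ (norm_le_enorm _))// normr_gt0 subr_eq0. Qed.

Lemma emod2_gt0 x1 y1 x2 y2 : x1 != y1 -> x2 != y2 -> 0 < emod2 x1 y1 x2 y2.
Proof. by move=> ? ?; rewrite mulr_gt0// powR_gt0// enorm_gt0. Qed.

Lemma rect_diff_diag b x1 y1 x2 y2 : (x1 == y1) || (x2 == y2) ->
  rect_diff b x1 y1 x2 y2 = 0.
Proof. by case/orP => /eqP ->; rewrite /rect_diff; ring. Qed.

Lemma holder_seminorm_le b (c : R) : holder_bound b1 b2 b c -> 0 <= c ->
  (holder_seminorm b1 b2 b <= c%:E)%E.
Proof.
move=> bc c0; apply: ge_ereal_sup => _ [x1 [y1 [x2 [y2 [xy1 xy2 ->]]]]].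
rewrite lee_fin ler_pdivrMr ?emod2_gt0//.
apply: le_trans (bc _ _ _ _) _.
by rewrite ler_wpM2l// mod2_le_emod2.
Qed.

Lemma holder_bound_seminorm b (c : R) : 0 <= c ->
  (holder_seminorm b1 b2 b <= c%:E)%E -> holder_bound b1 b2 b (c * dd).
Proof.
move=> c0 bc x1 y1 x2 y2.
have [xy|] := boolP ((x1 == y1) || (x2 == y2)).
  by rewrite rect_diff_diag// normr0 mulr_ge0 ?mod2_ge0// mulr_ge0// ltW.
rewrite negb_or => /andP[xy1 xy2].
rewrite -mulrA; apply: le_trans (ler_wpM2l c0 (emod2_le_mod2 _ _ _ _)).
rewrite -ler_pdivrMr ?emod2_gt0// -lee_fin (le_trans _ bc)//.
by apply: ereal_sup_ubound; exists x1, y1, x2, y2.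
Qed.

(** In positive dimensions the supremum is over a nonempty set, since 0 and the constant vector 1
    differ. *)
Lemma holder_seminorm_ge0 b : (0 <= holder_seminorm b1 b2 b)%E.
Proof.
have ne n : (0 < n)%N -> (const_mx 1 : 'rV[R]_n) != 0.
  move=> n0; apply/eqP => /rowP/(_ (Ordinal n0)); rewrite !mxE => /eqP.
  by rewrite oner_eq0.
have H x1 y1 x2 y2 : x1 != y1 -> x2 != y2 -> ((`|rect_diff b x1 y1 x2 y2| /
    emod2 x1 y1 x2 y2)%:E <= holder_seminorm b1 b2 b)%E.
  by move=> ? ?; apply: ereal_sup_ubound; exists x1, y1, x2, y2.
apply: le_trans (H _ _ _ _ (ne _ d1_gt0) (ne _ d2_gt0)).
by rewrite lee_fin divr_ge0// ltW// emod2_gt0// ne.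
Qed.

Lemma holder_boundP b : holder b1 b2 b ->
  exists2 C : R, 0 <= C & holder_bound b1 b2 b C.
Proof.
rewrite /holder /= => bfin.
have bf : holder_seminorm b1 b2 b \is a fin_num.
  by rewrite ge0_fin_numE ?holder_seminorm_ge0.
have f0 : 0 <= fine (holder_seminorm b1 b2 b) by rewrite fine_ge0 ?holder_seminorm_ge0.
exists (fine (holder_seminorm b1 b2 b) * dd); first by rewrite mulr_ge0// ltW.
by apply: holder_bound_seminorm => //; rewrite fineK.
Qed.

(** Nearness costs the factor [dd], the Euclidean norm being the larger; in the converse lemma it is
    farness that does. *)
Lemma sup_to_near_or_far n (t : R) (x y : 'rV[R]_n) : (0 < n)%N ->
  n%:R <= dd -> 0 < t ->
  sup_near_or_far (t / dd) x y -> near_or_far t x y.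
Proof.
move=> n0 ndd t0; have le : t / dd <= t by rewrite ler_pdivrMr// ler_peMr// ltW.
have tV : t^-1 <= (t / dd)^-1 by rewrite lef_pV2// posrE divr_gt0.
case=> h.
- apply: Or31; apply: le_lt_trans (enorm_le_norm _ n0) _.
  apply: (@le_lt_trans _ _ (dd * `|x - y|)); first by rewrite ler_wpM2r.
  by rewrite mulrC -ltr_pdivlMr.
- apply: Or32; exact: le_lt_trans tV (lt_le_trans h (norm_le_enorm _)).
- apply: Or33; exact: le_lt_trans tV (lt_le_trans h (norm_le_enorm _)).
Qed.

Lemma near_or_far_to_sup n (t : R) (x y : 'rV[R]_n) : (0 < n)%N ->
  n%:R <= dd -> 0 < t ->
  near_or_far (t / dd) x y -> sup_near_or_far t x y.
Proof.
move=> n0 ndd t0; have le : t / dd <= t by rewrite ler_pdivrMr// ler_peMr// ltW.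
have far (z : 'rV[R]_n) : (t / dd)^-1 < enorm z -> t^-1 < `|z|.
  rewrite invf_div => h; rewrite -(ltr_pM2l dd_gt0); apply: (lt_le_trans h).
  apply: le_trans (enorm_le_norm _ n0) _.
  by rewrite ler_wpM2r.
case=> h.
- by apply: Or31; exact: le_lt_trans (norm_le_enorm _) (lt_le_trans h le).
- by apply: Or32; exact: far.
- by apply: Or33; exact: far.
Qed.

Let d1_dd : d1%:R <= dd. Proof. by rewrite /dd ler_peMr// ler1n. Qed.
Let d2_dd : d2%:R <= dd. Proof. by rewrite /dd ler_peMl// ler1n. Qed.

Lemma VCP b : VC b1 b2 b <->
  (exists2 C : R, 0 <= C & holder_bound b1 b2 b C) /\ vanishing b1 b2 b.
Proof.
split=> [[hb vb]|[[C C0 bC] vb]].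
  split; first exact: holder_boundP.
  move=> e e0; have [t t0 bt] := vb (e / dd) (divr_gt0 e0 dd_gt0).
  exists (t / dd) => [|x1 y1 x2 y2 h]; first exact: divr_gt0.
  have h' : near_or_far t x1 y1 \/ near_or_far t x2 y2.
    by case: h => h; [left|right]; exact: sup_to_near_or_far h.
  apply: le_trans (bt _ _ _ _ h') _; rewrite -mulrA.
  apply: le_trans (ler_wpM2l _ (emod2_le_mod2 _ _ _ _)) _.
    by rewrite divr_ge0// ltW.
  by rewrite mulrA divfK// gt_eqF.
split.
  by apply: le_lt_trans (holder_seminorm_le bC C0) _; rewrite ltry.
move=> e e0; have [t t0 bt] := vb e e0.
exists (t / dd) => [|x1 y1 x2 y2 h]; first exact: divr_gt0.
have h' : sup_near_or_far t x1 y1 \/ sup_near_or_far t x2 y2.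
  by case: h => h; [left|right]; exact: near_or_far_to_sup h.
apply: le_trans (bt _ _ _ _ h') _; rewrite -mulrA ler_pM2l//.
exact: mod2_le_emod2.
Qed.

(** As the seminorm is nonnegative, its infimum is 0 exactly when it takes values below every
    positive bound; the change of norm costs [dd]. *)
Lemma holder_closureP (A : set ('rV[R]_d1 * 'rV[R]_d2 -> R)) b :
  holder_closure b1 b2 A b <->
  forall e : R, 0 < e -> exists2 phi, A phi & holder_bound b1 b2 (b \- phi) e.
Proof.
rewrite /holder_closure /=; split=> [inf0 e e0|H].
  have : (ereal_inf [set holder_seminorm b1 b2 (b \- phi)%R | phi in A] <
      (e / dd)%:E)%E by rewrite inf0 lte_fin divr_gt0.
  move=> /ereal_inf_lt[_ [phi Aphi <-]] h; exists phi => //.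
  rewrite -(@divfK _ dd _ e) ?gt_eqF//; apply: holder_bound_seminorm.
    by rewrite divr_ge0// ltW.
  exact: ltW.
apply/eqP; rewrite eq_le; apply/andP; split.
  apply/lee_addgt0Pr => e e0; rewrite add0e.
  have [phi Aphi /holder_seminorm_le h] := H e e0.
  apply: le_trans (h (ltW e0)); apply: ereal_inf_lbound.
  by exists phi.
apply: le_ereal_inf_tmp => _ [phi _ <-]; exact: holder_seminorm_ge0.
Qed.

Lemma holder_bound_vanishing_limit b :
  (forall e : R, 0 < e -> exists2 phi,
    (exists2 C : R, 0 <= C & holder_bound b1 b2 phi C) /\ vanishing b1 b2 phi &
    holder_bound b1 b2 (b \- phi) e) ->
  (exists2 C : R, 0 <= C & holder_bound b1 b2 b C) /\ vanishing b1 b2 b.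
Proof.
have split phi x1 y1 x2 y2 : `|rect_diff b x1 y1 x2 y2| <=
    `|rect_diff (b \- phi) x1 y1 x2 y2| + `|rect_diff phi x1 y1 x2 y2|.
  apply: le_trans (ler_normD _ _); rewrite le_eqVlt; apply/orP; left; apply/eqP.
  by congr `|_|; rewrite /rect_diff /=; ring.
move=> H; split.
  have [phi [[C C0 phiC] _] bphi] := H 1 ltr01.
  exists (1 + C); first by rewrite addr_ge0.
  move=> x1 y1 x2 y2; apply: le_trans (split phi _ _ _ _) _.
  by rewrite mulrDl lerD.
move=> e e0; have e2 : 0 < e / 2 by rewrite divr_gt0.
have [phi [_ vphi] bphi] := H _ e2.
have [t t0 ht] := vphi _ e2; exists t => // x1 y1 x2 y2 h.
apply: le_trans (split phi _ _ _ _) _.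
by rewrite [e in leRHS]splitr mulrDl lerD// ht.
Qed.

End EuclideanToSup.

Unset Implicit Arguments.

Theorem theorem3p1 (R : realType) (d1 d2 : nat) (beta1 beta2 : R)
    (hd1 : (0 < d1)%N) (hd2 : (0 < d2)%N)
    (hbeta1 : 0 < beta1 < 1) (hbeta2 : 0 < beta2 < 1) :
  VC beta1 beta2 =
  holder_closure beta1 beta2 (Cc_infty (V := ('rV[R]_d1 * 'rV[R]_d2)%type)).
Proof.
apply/seteqP; split=> b.
  move=> /(VCP hbeta1 hbeta2 hd1 hd2)[[C C0 bC] bv].
  apply/(holder_closureP hbeta1 hbeta2 hd1 hd2) => e e0.
  have [K K0 HK] := VC_approx hbeta1 hbeta2 C0 bC bv.
  (* [K] may be 0, so the error [e] is divided by K + 1. *)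
  have K1 : 0 < K + 1 by rewrite ltr_wpDl.
  have [phi Cphi bphi] := HK _ (divr_gt0 e0 K1).
  exists phi => // x1 y1 x2 y2; apply: le_trans (bphi _ _ _ _) _.
  rewrite ler_wpM2r ?mod2_ge0// mulrA ler_pdivrMr// mulrC ler_pM2l//.
  by rewrite lerDl.
move=> /(holder_closureP hbeta1 hbeta2 hd1 hd2) bcl.
apply/(VCP hbeta1 hbeta2 hd1 hd2).
apply: holder_bound_vanishing_limit => e /bcl[phi Cphi bphi].
by exists phi => //; exact: Cc_infty_holder_vanishing.
Qed.
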